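(* Let $m,n\ge 1$ be integers with $mn\ge 2$. Let $f_1,\dots,f_m\in L^1_{loc}(\mathbb{R}^n)$ and let $x\in\mathbb{R}^n$. Then for every $0<\alpha<1$, $$M^m(f_1,\dots,f_m)(x)\le S^m_\alpha(f_1,\dots,f_m)(x)\le S^m(f_1,\dots,f_m)(x),$$ and $$\lim_{\alpha\to1^-}S^m_\alpha(f_1,\dots,f_m)(x)=S^m(f_1,\dots,f_m)(x).$$ These statements hold in $[0,\infty]$, i.e. they are valid even when some of the expressions equal $\infty$. Moreover, if $S^m_{\alpha_0}(f_1,\dots,f_m)(x)<\infty$ for some $\alpha_0\in(0,1)$, then $$\lim_{\alpha\to0^+}S^m_\alpha(f_1,\dots,f_m)(x)=M^m(f_1,\dots,f_m)(x).$$
   Context: Notation: $\mathbb{B}^{\kappa}$ is the unit ball and $\mathbb{S}^{\kappa-1}$ the unit sphere of $\mathbb{R}^\kappa$; $v_\kappa$ is the Lebesgue measure of $\mathbb{B}^\kappa$; $d\sigma_{\kappa-1}$ is the (unnormalized) surface measure on $\mathbb{S}^{\kappa-1}$ and $\omega_{\kappa-1}=\sigma_{\kappa-1}(\mathbb{S}^{\kappa-1})$; $B(a,b)=\int_0^1 t^{a-1}(1-t)^{b-1}\,dt$ is the beta function. Points of $\mathbb{R}^{mn}=(\mathbb{R}^n)^m$ are written $y=(y_1,\dots,y_m)$, respectively $(\theta_1,\dots,\theta_m)$ on the sphere, with $y_i,\theta_i\in\mathbb{R}^n$. For $f_1,\dots,f_m\in L^1_{loc}(\mathbb{R}^n)$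 and $x\in\mathbb{R}^n$ define $$M^m(f_1,\dots,f_m)(x)=\sup_{t>0}\frac1{v_{mn}}\int_{\mathbb{B}^{mn}}\prod_{i=1}^m|f_i(x-ty_i)|\,dy_1\cdots dy_m,$$ $$S^m_\alpha(f_1,\dots,f_m)(x)=\operatorname*{ess\,sup}_{t>0}\ \frac{2}{\omega_{mn-1}B(\frac{mn}{2},1-\alpha)}\int_{\mathbb{B}^{mn}}\prod_{i=1}^m|f_i(x-ty_i)|\,\frac{dy}{(1-|y|^2)^{\alpha}}\qquad(0\le\alpha<1),$$ $$S^m(f_1,\dots,f_m)(x)=\operatorname*{ess\,sup}_{t>0}\ \frac1{\omega_{mn-1}}\int_{\mathbb{S}^{mn-1}}\prod_{i=1}^m|f_i(x-t\theta_i)|\,d\sigma_{mn-1}(\theta_1,\dots,\theta_m).$$ (For locally integrable $f_i$ and fixed $x$ the last two integrals are finite for almost every $t>0$; the essential suprema are with respect to Lebesgue measure in $t\in(0,\infty)$.) All these quantities take values in $[0,\infty]$. *)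

(* Defs.v *)
From HB Require Import structures.
From mathcomp Require Import all_boot all_order all_algebra.
From mathcomp Require Import all_classical all_reals all_analysis.
From mathcomp Require Import measurable_realfun ess_sup_inf.
Set Implicit Arguments.
Unset Strict Implicit.
Unset Printing Implicit Defensive.
Import Order.TTheory GRing.Theory Num.Theory.
Import numFieldNormedType.Exports.
Local Open Scope classical_set_scope.
Local Open Scope ring_scope.

(* R^n is 'rV[R]_n with the product (= Borel) sigma-algebra.  In all the
   integrals below the integrand is nonnegative, and the library integral is
   then the supremum of the integrals of the Borel simple functions below it;
   for a Lebesgue-measurable, possibly non-Borel, integrand this is its usual
   Lebesgue integral. *)
Section rV_measurable.
Context (R : realType) (n : nat).

Definition coor (i : 'I_n) (v : 'rV[R]_n) : R := v ord0 i.

Let rV_set0 : g_sigma_preimage coor set0.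
Proof. exact: sigma_algebra0. Qed.

Let rV_setC A : g_sigma_preimage coor A -> g_sigma_preimage coor (~` A).
Proof. exact: sigma_algebraC. Qed.

Let rV_bigcup (F : (set 'rV[R]_n)^nat) :
  (forall i, g_sigma_preimage coor (F i)) ->
  g_sigma_preimage coor (\bigcup_i (F i)).
Proof. exact: sigma_algebra_bigcup. Qed.

HB.instance Definition _ := @isMeasurable.Build default_measure_display
  'rV[R]_n (g_sigma_preimage coor) rV_set0 rV_setC rV_bigcup.

Lemma measurable_coor i : measurable_fun [set: 'rV[R]_n] (coor i).
Proof.
move=> _ Y mY; rewrite setTI; apply: sub_sigma_algebra => /=.
rewrite -bigcup_seq/=; exists i => /=; first by rewrite mem_index_enum.
by exists Y => //; rewrite setTI.
Qed.

Lemma measurable_fun_rVP d (T : measurableType d) (f : T -> 'rV[R]_n) :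
  measurable_fun [set: T] f <->
  forall i, measurable_fun [set: T] (coor i \o f).
Proof.
split=> [mf i|mf]; first exact: measurableT_comp (measurable_coor i) mf.
move=> _ A mA; rewrite setTI.
suff : preimage_set_system [set: T] f (g_sigma_preimage coor) `<=` measurable.
  by move=> h; apply: h; exists A => //; rewrite setTI.
rewrite -g_sigma_preimage_comp.
apply: smallest_sub; first exact: sigma_algebra_measurable.
rewrite -bigcup_seq/=; apply: bigcup_sub => i _ B [C mC <-].
exact: mf.
Qed.

End rV_measurable.

Definition cons_rV (R : realType) n (p : R * 'rV[R]_n) : 'rV[R]_n.+1 :=
  row_mx p.1%:M p.2.

Lemma cons_rV0 (R : realType) n (p : R * 'rV[R]_n) :
  cons_rV p ord0 ord0 = p.1.
Proof.
rewrite /cons_rV (_ : ord0 = lshift n (@ord0 0)); last exact/val_inj.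
by rewrite [LHS](@row_mxEl R 1 1 n) mxE eqxx.
Qed.

Lemma cons_rVS (R : realType) n (p : R * 'rV[R]_n) (i : 'I_n) :
  cons_rV p ord0 (lift ord0 i) = p.2 ord0 i.
Proof.
rewrite /cons_rV (_ : lift ord0 i = rshift 1 i); last exact/val_inj.
by rewrite [LHS](@row_mxEr R 1 1 n).
Qed.

Lemma measurable_cons_rV (R : realType) n :
  measurable_fun setT (@cons_rV R n).
Proof.
apply/measurable_fun_rVP => i; have [j ->|->] := unliftP ord0 i.
- apply: (eq_measurable_fun (fun p => coor j p.2)).
    by move=> p _; rewrite /coor /= cons_rVS.
  exact: measurableT_comp (measurable_coor j) measurable_snd.
- by apply: (eq_measurable_fun fst) => // p _; rewrite /coor /= cons_rV0.
Qed.

Definition image_measure d1 d2 (T1 : measurableType d1) (T2 : measurableType d2)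
    (R : realType) (mu : {measure set T1 -> \bar R}) (f : T1 -> T2)
    (mf : measurable_fun [set: T1] f) : {measure set T2 -> \bar R} :=
  measure_function_pushforward__canonical__measure_function_Measure mu mf.

Fixpoint rV_lebesgue (R : realType) (n : nat) :
    {measure set 'rV[R]_n -> \bar R} :=
  match n with
  | 0 => dirac (0 : 'rV[R]_0)
  | n'.+1 => image_measure (lebesgue_measure \x^ rV_lebesgue R n')%E
                           (@measurable_cons_rV R n')
  end.

Lemma measurable_box (R : realType) n (A : 'I_n -> set R) :
  (forall i, measurable (A i)) ->
  measurable [set v : 'rV[R]_n | forall i, A i (v ord0 i)].
Proof.
move=> mA; rewrite (_ : [set _ | _] = \bigcap_(i in [set: 'I_n]) (coor i @^-1` A i)).
  apply: fin_bigcap_measurable => // i _.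
  by rewrite -[_ @^-1` _]setTI; exact: measurable_coor.
by apply/seteqP; split => v /= Av i; [move=> _|]; exact: Av.
Qed.

Lemma rV_lebesgue_box (R : realType) n (A : 'I_n -> set R) :
  (forall i, measurable (A i)) ->
  rV_lebesgue R n [set v : 'rV[R]_n | forall i, A i (v ord0 i)] =
  (\prod_(i < n) lebesgue_measure (A i))%E.
Proof.
elim: n A => [|n IHn] A mA.
  by rewrite big_ord0 /= diracE mem_set// => -[].
rewrite big_ord_recl -IHn//.
rewrite -product_measure2E; [|exact: mA|exact: (@measurable_box R n (fun i => A (lift ord0 i)) (fun i => mA _))].
rewrite /= /pushforward/=; congr (_ _).
apply/seteqP; split => [[a v]|[a v]]/=.
- move=> Aav; split=> [|i]; first by have := Aav ord0; rewrite cons_rV0.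
  by have := Aav (lift ord0 i); rewrite cons_rVS.
- move=> [A0a Av] i; have [j ->|->] := unliftP ord0 i.
    by rewrite cons_rVS; exact: Av.
  by rewrite cons_rV0.
Qed.

Section euclidean.
Context (R : realType) (k : nat).
Implicit Types y : 'rV[R]_k.

Definition enorm y : R := Num.sqrt (\sum_(i < k) y ord0 i ^+ 2).

Definition unit_ball : set 'rV[R]_k := [set y | enorm y < 1].

Definition unit_sphere : set 'rV[R]_k := [set y | enorm y = 1].

Definition radial_proj y : 'rV[R]_k := (enorm y)^-1 *: y.

Lemma measurable_enorm : measurable_fun setT enorm.
Proof.
have msqrt : measurable_fun [set: R] (@Num.sqrt R).
  by apply: continuous_measurable_fun; exact: sqrt_continuous.
apply: (measurableT_comp msqrt); apply: measurable_sum => i.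
by apply: measurable_funX; exact: measurable_coor.
Qed.

Lemma measurable_unit_ball : measurable unit_ball.
Proof.
rewrite (_ : unit_ball = setT `&` enorm @^-1` `]-oo, 1[).
  by apply: measurable_enorm => //; exact: measurable_itv.
by rewrite setTI; apply/seteqP; split => y /=; rewrite in_itv.
Qed.

Lemma measurable_radial_proj : measurable_fun setT radial_proj.
Proof.
apply/measurable_fun_rVP => i.
apply: (eq_measurable_fun (fun y => (enorm y)^-1 * coor i y)).
  by move=> y _; rewrite /coor /= /radial_proj mxE.
apply: measurable_funM; last exact: measurable_coor.
apply: (eq_measurable_fun (fun y => enorm y `^ (-1))).
  by move=> y _; rewrite /= powR_inv1// sqrtr_ge0.
exact: (measurableT_comp (measurable_powR (-1)) measurable_enorm).
Qed.

(* The surface measure of the unit sphere, constructed from Lebesgue measure: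
   sigma(A) = k * Leb({y | 0 < |y| < 1, y / |y| \in A}) for every Borel subset
   A of the sphere.  The point y = 0 is sent to 0, which is not on the sphere,
   so it does not contribute. *)
Definition sphere_measure : {measure set 'rV[R]_k -> \bar R} :=
  mscale k%:R%:nng
    (image_measure (mrestr (rV_lebesgue R k) measurable_unit_ball)
                   measurable_radial_proj).

Definition ball_volume : R := fine (rV_lebesgue R k unit_ball).

Definition sphere_area : R := fine (sphere_measure unit_sphere).

(* Elements of L^1_loc are classes modulo a.e. equality, so f is only required
   to have a Borel representative g integrable on compact sets, i.e. f may be
   any Lebesgue-measurable function. *)
Definition L1loc (f : 'rV[R]_k -> R) :=
  exists g : 'rV[R]_k -> R,
  [/\ measurable_fun setT g,
      {ae rV_lebesgue R k, forall y, f y = g y} &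
      forall K : set 'rV[R]_k, compact K ->
        (rV_lebesgue R k).-integrable K (EFin \o g)].

End euclidean.
Arguments unit_ball {R k}.
Arguments unit_sphere {R k}.

Definition euler_beta (R : realType) (a b : R) : R :=
  (\int[lebesgue_measure]_(t in `]0, 1[) (t `^ (a - 1) * (1 - t) `^ (b - 1)))%R.

Section maximal.
Context (R : realType) (m n : nat).
Implicit Types (f : 'I_m -> 'rV[R]_n -> R) (x : 'rV[R]_n) (t : R).

(* y_i, for y = (y_1, ..., y_m) in R^{mn} = (R^n)^m. *)
Definition block (y : 'rV[R]_(m * n)) (i : 'I_m) : 'rV[R]_n :=
  row i (vec_mx y).

Definition tensor f x t (y : 'rV[R]_(m * n)) : R :=
  \prod_(i < m) `|f i (x - t *: block y i)|.

Definition ess_sup_pos (F : R -> \bar R) : \bar R :=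
  ess_sup (mrestr lebesgue_measure (measurable_itv `]0%R, +oo[)) F.

Definition Mmax f x : \bar R :=
  ereal_sup [set ((ball_volume R (m * n))^-1%:E *
      \int[rV_lebesgue R (m * n)]_(y in unit_ball) (tensor f x t y)%:E)%E
    | t in [set t : R | 0 < t]].

Definition Smax_alpha (alpha : R) f x : \bar R :=
  ess_sup_pos (fun t =>
    ((2 / (sphere_area R (m * n) * euler_beta ((m * n)%:R / 2) (1 - alpha)))%:E *
     \int[rV_lebesgue R (m * n)]_(y in unit_ball)
       (tensor f x t y / (1 - enorm y ^+ 2) `^ alpha)%:E)%E).

Definition Smax f x : \bar R :=
  ess_sup_pos (fun t =>
    ((sphere_area R (m * n))^-1%:E *
     \int[sphere_measure R (m * n)]_(y in unit_sphere) (tensor f x t y)%:E)%E).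

End maximal.

(* Main.v *)
(* Put k = mn and Phi(y) = prod_i |f_i(x - y_i)| on R^k, so that all three integrals
   at scale t are averages of Phi(t y).  Write W(alpha) for the integral of
   (1-|y|^2)^(-alpha) over the unit ball; polar coordinates give
   W(alpha) = omega_(k-1) B(k/2, 1-alpha) / 2 and show that a weighted ball average is
   an average of spherical averages at smaller scales, whence S_alpha <= S.
   - M <= S_alpha: the uniform average over a ball is a mixture over s in (0,1) of the
     weighted averages at scale t s, by the product rule for beta distributions.
   - alpha -> 1: if S > L then the spherical mean A has integral > L (b - a) over some
     interval ]a, b].  Since W(alpha) >= v_k / (1-alpha) tends to infinity, the weighted
     averages concentrate at radius 1, and integrating them over a slightly larger
     interval of scales shows that S_alpha > L for alpha close to 1.
   - alpha -> 0: for alpha = theta alpha0, concavity gives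
     (1-|y|^2)^(-alpha) <= 1 - theta + theta (1-|y|^2)^(-alpha0), hence
     M <= S_alpha <= M + theta C, where C is finite as soon as S_alpha0 is. *)
From HB Require Import structures.
Require Import Defs.
From mathcomp Require Import all_boot all_order all_algebra.
From mathcomp Require Import all_classical all_reals all_analysis.
From mathcomp Require Import measurable_realfun ess_sup_inf.
From mathcomp Require Import ring lra.
Set Implicit Arguments.
Unset Strict Implicit.
Unset Printing Implicit Defensive.
Import Order.TTheory GRing.Theory Num.Theory.
Import numFieldNormedType.Exports.
Local Open Scope classical_set_scope.
Local Open Scope ring_scope.

(** * Lebesgue measure on row vectors *)

(** [sphere_measure] is an image of Lebesgue measure on the ball under radial projection, so a
    spherical mean is itself a ball integral: that of [Phi (t *: radial_proj y)], divided by v_k.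
    Polar coordinates thus become an identity between ball integrals, within reach of Tonelli and
    linear substitutions. Two obstacles shape the rest. The spherical mean A need not be integrable
    near t = 0 and is treated only as a measurable function into [0,+oo]; so the limit at 1 avoids
    Lebesgue differentiation, and a bound for A on all intervals becomes an a.e. bound by covering
    sets with intervals, as in the definition of outer measure. Moreover the f_i agree with Borel
    functions only off null sets, and every sphere is itself null in R^k: a given sphere may lie
    inside the exceptional set. For almost every radius the two meet in a set of surface measure 0,
    and this is again a consequence of the concentration argument. Essential suprema enter through
    the a.e. bounds they satisfy, and the two inequalities are proved with bounds in [0,+oo]. *)

Definition box (R : realType) n (A : 'I_n -> set R) : set 'rV[R]_n :=
  [set v | forall i, A i (v ord0 i)].

Lemma rV_measurableE (R : realType) n :
  @measurable _ 'rV[R]_n =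
  <<s [set X | exists2 A : 'I_n -> set R,
        (forall i, measurable (A i)) & X = box A] >>.
Proof.
apply/seteqP; split.
  apply: smallest_sub; first exact: smallest_sigma_algebra.
  rewrite -bigcup_seq/=; apply: bigcup_sub => i _ B [C mC <-].
  apply: sub_sigma_algebra; exists (fun j => if j == i then C else setT).
    by move=> j; case: ifP.
  rewrite setTI; apply/seteqP; split => v /=.
    by move=> Cv j; case: ifP => // /eqP ->.
  by move=> /(_ i); rewrite eqxx.
apply: smallest_sub; first exact: sigma_algebra_measurable.
by move=> _ [A mA ->]; exact: measurable_box.
Qed.

Definition cube (R : realType) n (N : nat) : set 'rV[R]_n :=
  box (fun=> [set` `[- N%:R, N%:R]]).

Lemma bigcup_cube (R : realType) n : \bigcup_N @cube R n N = setT.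
Proof.
apply/seteqP; split => // v _.
pose M := \sum_(i < n) `|v ord0 i|.
exists (Num.truncn M).+1 => //= i /=; rewrite in_itv/= -ler_norml.
apply: (@le_trans _ _ M); last exact/ltW/truncnS_gt.
by rewrite /M (bigD1 i)//= lerDl sumr_ge0.
Qed.

Lemma measurable_cube (R : realType) n N : measurable (@cube R n N).
Proof. exact: measurable_box. Qed.

(** Boxes generate the sigma-algebra and are stable under intersection, and the cubes exhaust the
    space with finite mass, so uniqueness of measures applies. It reduces dilations and coordinate
    projections to products of one-dimensional measures. *)
Lemma rV_measure_ext (R : realType) n
    (mu nu : {measure set 'rV[R]_n -> \bar R}) :
  (forall A : 'I_n -> set R, (forall i, measurable (A i)) ->
    mu (box A) = nu (box A)) ->
  (forall N : nat, (mu (cube N) < +oo)%E) ->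
  forall X, measurable X -> mu X = nu X.
Proof.
move=> mn muoo.
apply: (measure_unique _ (@cube R n)
  (rV_measurableE R n)) => //.
- move=> _ _ [A mA ->] [B mB ->]; exists (fun i => A i `&` B i).
    by move=> i; exact: measurableI.
  apply/seteqP; split => v /=; first by move=> [Av Bv] i; split.
  by move=> AB; split => i; have [] := AB i.
- by move=> N; eexists; last by []; move=> i; exact: measurable_itv.
- exact: bigcup_cube.
- by move=> _ [A mA ->]; exact: mn.
Qed.

(* An alias, because HB cannot attach the sigma-finite structure to the
   structure-valued fixpoint [rV_lebesgue] itself. *)
Definition vol (R : realType) n : set 'rV[R]_n -> \bar R := rV_lebesgue R n.

HB.instance Definition _ (R : realType) n :=
  Measure.copy (@vol R n) (rV_lebesgue R n).

Lemma vol_box (R : realType) n (A : 'I_n -> set R) :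
  (forall i, measurable (A i)) ->
  vol (box A) = (\prod_(i < n) lebesgue_measure (A i))%E.
Proof. exact: rV_lebesgue_box. Qed.

Lemma vol_cube_lty (R : realType) n N : (vol (@cube R n N) < +oo)%E.
Proof.
rewrite vol_box; last by move=> i; exact: measurable_itv.
under eq_bigr do rewrite lebesgue_measure_itv/=.
rewrite (_ : (if _ then _ else _) = (N%:R + N%:R)%:E); last first.
  by case: ifPn => [|]; rewrite lte_fin ?EFinN ?oppeK// -leNgt => N0;
     rewrite (_ : N%:R = 0 :> R) ?addr0//; have := ler0n R N; lra.
by rewrite prodEFin ltry.
Qed.

Lemma vol_sigma_finite (R : realType) n : sigma_finite setT (@vol R n).
Proof.
exists (@cube R n); first by rewrite bigcup_cube.
by move=> N; split; [exact: measurable_cube|exact: vol_cube_lty].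
Qed.

HB.instance Definition _ (R : realType) n :=
  @Measure_isSigmaFinite.Build _ _ _ (@vol R n) (vol_sigma_finite R n).

Lemma measurable_affine (R : realType) (a t : R) :
  measurable_fun setT (fun s : R => a + t * s).
Proof. by apply: measurable_funD => //; exact: measurable_funM. Qed.

Lemma lebesgue_measure_affine (R : realType) (a t : R) (A : set R) :
  t != 0 -> measurable A ->
  lebesgue_measure ((fun s : R => (a + t * s)%R) @^-1` A) =
  (`|t|^-1%:E * lebesgue_measure A)%E.
Proof.
move=> t0 mA.
have Vt0 : 0 <= `|t| by [].
pose nu := mscale (NngNum Vt0)
  (@image_measure _ _ _ (measurableTypeR R) _ (@lebesgue_measure R) _
     (measurable_affine a t)).
have nuE X : nu X = (`|t|%:E * lebesgue_measure ((fun s : R => (a + t * s)%R) @^-1` X))%E by [].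
suff -> : lebesgue_measure A = nu A.
  by rewrite nuE muleA -EFinM mulVf ?normr_eq0// mul1e.
apply: lebesgue_measure_unique => // _ [[b c] _ <-]; rewrite [RHS]nuE /=.
have [t_gt0|t_lt0|/eqP] := ltgtP 0 t; last by rewrite eq_sym (negbTE t0).
- rewrite (_ : _ @^-1` _ = `](b - a) / t, (c - a) / t]%classic); last first.
    apply/seteqP; split => s /=; rewrite !in_itv/= ltr_pdivrMr// ler_pdivlMr//;
      move=> /andP[? ?]; apply/andP; split; lra.
  rewrite !lebesgue_measure_itv/= !lte_fin ltr_pM2r ?invr_gt0// ltrBlDr subrK.
  case: ifPn => _; last by rewrite mule0.
  by rewrite -!EFinD -EFinM gtr0_norm//; congr EFin; field.
(* A negative factor reverses the interval, so the closed end changes side; the length is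
   unaffected. *)
- rewrite (_ : _ @^-1` _ = `[(c - a) / t, (b - a) / t[%classic); last first.
    apply/seteqP; split => s /=; rewrite !in_itv/= ler_ndivrMr// ltr_ndivlMr//;
      move=> /andP[? ?]; apply/andP; split; lra.
  rewrite !lebesgue_measure_itv/= !lte_fin ltr_nM2r ?invr_lt0// ltrBlDr subrK.
  case: ifPn => _; last by rewrite mule0.
  by rewrite -!EFinD -EFinM ltr0_norm//; congr EFin; field.
Qed.

Lemma measurable_affine_rV (R : realType) n (x : 'rV[R]_n) (t : R) :
  measurable_fun setT (fun y : 'rV[R]_n => x + t *: y).
Proof.
apply/measurable_fun_rVP => i.
apply: (eq_measurable_fun (fun y => x ord0 i + t * coor i y)).
  by move=> y _; rewrite /coor /= !mxE.
by apply: measurable_funD => //; apply: measurable_funM => //;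
  exact: measurable_coor.
Qed.

Lemma vol_affine (R : realType) n (x : 'rV[R]_n) (t : R) (A : set 'rV[R]_n) :
  t != 0 -> measurable A ->
  vol ((fun y => x + t *: y)%R @^-1` A) = ((`|t| ^- n)%:E * vol A)%E.
Proof.
move=> t0 mA.
have Vt0 : 0 <= `|t| ^+ n by rewrite exprn_ge0.
pose nu := mscale (NngNum Vt0)
  (image_measure (@vol R n) (measurable_affine_rV x t)).
have nuE X : nu X =
  ((`|t| ^+ n)%:E * vol ((fun y => x + t *: y)%R @^-1` X))%E by [].
suff -> : vol A = nu A.
  by rewrite nuE muleA -EFinM mulVf ?mul1e// expf_neq0// normr_eq0.
apply: rV_measure_ext => // [B mB|N]; last exact: vol_cube_lty.
rewrite [RHS]nuE.
have -> : (fun y => x + t *: y)%R @^-1` box B =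
    box (fun i => (fun s => (x ord0 i + t * s)%R) @^-1` B i).
  by apply/seteqP; split => y /= By i; have := By i; rewrite /= !mxE.
rewrite !vol_box//; last first.
  by move=> i; rewrite -[X in measurable X]setTI; exact: measurable_affine.
under [in RHS]eq_bigr do rewrite lebesgue_measure_affine//.
rewrite big_split/= prodEFin prodr_const card_ord muleA -EFinM.
by rewrite exprVn mulfV ?mul1e ?vol_box//= expf_neq0// normr_eq0.
Qed.

Lemma ge0_integral_scale (R : realType) n (t : R) (G : 'rV[R]_n -> \bar R) :
  0 < t -> measurable_fun setT G -> (forall y, 0 <= G y)%E ->
  (\int[@vol R n]_y G (t *: y)%R = (t ^- n)%:E * \int[@vol R n]_y G y)%E.
Proof.
move=> t0 mG G0.
have Vt0 : 0 <= t ^- n by rewrite invr_ge0 exprn_ge0// ltW.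
transitivity (\int[mscale (NngNum Vt0) (@vol R n)]_y G y)%E; last first.
  by rewrite ge0_integral_mscale.
pose m := image_measure (@vol R n) (measurable_affine_rV 0 t).
transitivity (\int[m]_y G y)%E.
  rewrite [RHS]ge0_integral_pushforward//.
    by rewrite preimage_setT; apply: eq_integral => y _ /=; rewrite add0r.
  exact: measurable_affine_rV.
apply: eq_measure_integral => A mA _.
rewrite /m /= /pushforward vol_affine// ?gt_eqF// gtr0_norm//.
Qed.

Lemma ge0_integral_affine1 (R : realType) (a t : R) (G : R -> \bar R) :
  t != 0 -> measurable_fun setT G -> (forall y, 0 <= G y)%E ->
  (\int[@lebesgue_measure R]_s G (a + t * s)%R =
   `|t|^-1%:E * \int[@lebesgue_measure R]_s G s)%E.
Proof.
move=> t0 mG G0.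
have Vt0 : 0 <= `|t|^-1 by rewrite invr_ge0.
transitivity (\int[mscale (NngNum Vt0) (@lebesgue_measure R)]_y G y)%E; last first.
  by rewrite ge0_integral_mscale.
pose m := @image_measure _ _ _ (measurableTypeR R) _ (@lebesgue_measure R) _
  (measurable_affine a t).
transitivity (\int[m]_y G y)%E.
  by rewrite [RHS]ge0_integral_pushforward//; exact: measurable_affine.
apply: eq_measure_integral => A mA _.
by rewrite /m /= /pushforward lebesgue_measure_affine.
Qed.

Lemma ge0_integral_scale1 (R : realType) (t : R) (G : R -> \bar R) :
  0 < t -> measurable_fun setT G -> (forall y, 0 <= G y)%E ->
  (\int[@lebesgue_measure R]_s G (t * s)%R =
   t^-1%:E * \int[@lebesgue_measure R]_s G s)%E.
Proof.
move=> t0 mG G0; rewrite -{2}(gtr0_norm t0) -(ge0_integral_affine1 0)//.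
  by apply: eq_integral => s _; rewrite add0r.
by rewrite gt_eqF.
Qed.

(** Taken with the indices [s] of one block of (R^n)^m, this carries an a.e. equality of the f_i
    over to their tensor product. *)
Lemma vol_select_null (R : realType) n k (s : 'I_n -> 'I_k)
    (N : set 'rV[R]_n) : injective s -> measurable N -> vol N = 0%E ->
  vol ((fun y : 'rV[R]_k => \row_j y ord0 (s j)) @^-1` N) = 0%E.
Proof.
move=> sI mN N0.
have ms : measurable_fun setT (fun y : 'rV[R]_k => \row_j y ord0 (s j)).
  apply/measurable_fun_rVP => j.
  apply: (eq_measurable_fun (coor (s j))); last exact: measurable_coor.
  by move=> y _; rewrite /coor /= mxE.
(* [N] is only controlled in the selected coordinates; the other ones are cut
   down to [-M, M], where the two sides become proportional measures. *)
pose C (M : nat) (l : 'I_k) : set R :=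
  if l \in codom s then setT else [set` `[- M%:R, M%:R]].
have mC M l : measurable (C M l) by rewrite /C; case: ifP.
have mbC M : measurable (box (C M)) by exact: measurable_box.
have slice M : vol ((fun y : 'rV[R]_k => \row_j y ord0 (s j)) @^-1` N `&` box (C M)) = 0%E.
  have c0 : (0 : R) <= \prod_(l < k | l \notin codom s) (M%:R + M%:R).
    by apply: prodr_ge0 => l _; rewrite addr_ge0.
  pose mu := image_measure (mrestr (@vol R k) (mbC M)) ms.
  pose nu := mscale (NngNum c0) (@vol R n).
  have nuE X : nu X = ((\prod_(l < k | l \notin codom s) (M%:R + M%:R))%:E * vol X)%E by [].
  rewrite -[LHS]/(mu N) -(_ : nu N = mu N); first by rewrite nuE N0 mule0.
  apply: rV_measure_ext => // [A mA|L]; last first.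
    by rewrite [ltLHS]nuE lte_mul_pinfty// vol_cube_lty.
  (* The preimage of a box, cut down by [C M], is again a box: its side is [A j] in the coordinate
     [s j] and [C M l] in the others. Injectivity of [s] makes [j] unique. *)
  pose B l := if [pick j | s j == l] is Some j then A j else C M l.
  have BE j : B (s j) = A j.
    by rewrite /B; case: pickP => [i /eqP/sI->//|/(_ j)]; rewrite eqxx.
  have BN l : l \notin codom s -> B l = C M l.
    rewrite /B; case: pickP => // i /eqP <-.
    by rewrite codom_f.
  rewrite [LHS]nuE vol_box//.
  transitivity (vol (box B)); last first.
    congr vol; apply/seteqP; split => y /= By.
      split=> [j|l]; first by rewrite mxE -BE.
      rewrite /C; case: ifPn => // lN.
      by have := By l; rewrite BN// /C (negbTE lN).
    move=> l; have [/codomP[j ->]|lN] := boolP (l \in codom s).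
      by rewrite BE; have := By.1 j; rewrite mxE.
    by rewrite BN//; exact: By.2.
  rewrite vol_box; last by move=> l; rewrite /B; case: pickP.
  rewrite [RHS](bigID (fun l => l \in codom s))/= muleC; congr (_ * _)%E.
    rewrite (eq_bigl (mem (s @: [set: 'I_n]%SET))); last first.
      move=> l; apply/codomP/imsetP => [[j ->]|[j _ ->]]; last by exists j.
      by exists j; rewrite // inE.
    rewrite big_imset/=; last by move=> i j _ _; exact: sI.
    by apply: eq_big => [j|j _]; [rewrite inE|rewrite BE].
  rewrite -prodEFin; apply: eq_bigr => l lN; rewrite BN// /C (negbTE lN).
  rewrite lebesgue_measure_itv/= lte_fin.
  case: ifPn => [|]; rewrite ?EFinN ?oppeK// -leNgt => M0.
  by rewrite (_ : M%:R = 0 :> R) ?addr0//; have := ler0n R M; lra.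
set E := _ @^-1` N in slice *.
have -> : E = \bigcup_M (E `&` box (C M)).
  rewrite -setI_bigcupr (_ : \bigcup_M box (C M) = setT) ?setIT//.
  apply/seteqP; split => // y _.
  have : (\bigcup_N @cube R k N) y by rewrite bigcup_cube.
  by move=> [M _ My]; exists M => // l; rewrite /C; case: ifP => // _; exact: My.
apply/eqP; rewrite eq_le measure_ge0 andbT.
have mE : measurable E by rewrite /E -[X in measurable X]setTI; exact: ms.
rewrite (le_trans (generalized_Boole_inequality _ _ _))//.
- by move=> M; exact: measurableI.
- by apply: bigcup_measurable => M _; exact: measurableI.
- by rewrite eseries0// => M _ _; exact: slice.
Qed.

Section integral_if.
Context d (T : measurableType d) (R : realType).
Variable mu : {measure set T -> \bar R}.
Local Open Scope ereal_scope.

(** With the domain moved into a boolean conditional, a domain that depends on the other variable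
    becomes part of one integrand on a product space, as Tonelli requires. *)
Lemma integral_if (D : set T) (P : T -> bool) (f : T -> \bar R) :
  (forall x, D x <-> P x) ->
  \int[mu]_(x in D) f x = \int[mu]_x (if P x then f x else 0).
Proof.
move=> DP; rewrite integral_mkcond; apply: eq_integral => x _.
rewrite patchE; congr (if _ then _ else _).
by apply/idP/idP => [/set_mem/DP|/DP/mem_set].
Qed.

End integral_if.

Section enorm.
Context (R : realType) (k : nat).
Implicit Types y : 'rV[R]_k.

Lemma enorm_ge0 y : 0 <= enorm y. Proof. exact: sqrtr_ge0. Qed.

Lemma enormZ (t : R) y : enorm (t *: y) = `|t| * enorm y.
Proof.
rewrite /enorm -sqrtr_sqr -sqrtrM ?sqr_ge0//; congr Num.sqrt.
by rewrite mulr_sumr; apply: eq_bigr => i _; rewrite mxE exprMn.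
Qed.

Lemma enorm_eq0 y : enorm y = 0 -> y = 0.
Proof.
move/eqP; rewrite sqrtr_eq0 => h; apply/rowP => i; rewrite mxE.
apply/eqP; rewrite -sqrf_eq0 eq_le sqr_ge0 andbT; apply: le_trans h.
by rewrite (bigD1 i)//= lerDl sumr_ge0// => j _; exact: sqr_ge0.
Qed.

Lemma enorm0 : enorm (0 : 'rV[R]_k) = 0.
Proof. by rewrite -[0](scale0r 0) enormZ normr0 mul0r. Qed.

Lemma ler_coor_enorm y i : `|y ord0 i| <= enorm y.
Proof.
rewrite /enorm -sqrtr_sqr ler_sqrt; last first.
  by apply: sumr_ge0 => j _; exact: sqr_ge0.
by rewrite (bigD1 i)//= lerDl sumr_ge0// => j _; exact: sqr_ge0.
Qed.

Lemma set0_box : [set (0 : 'rV[R]_k)] = box (fun=> [set 0]).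
Proof.
apply/seteqP; split => [_ -> i|y y0]/=; first by rewrite mxE.
by apply/rowP => i; rewrite mxE; exact: y0.
Qed.

Lemma vol_set0 : (0 < k)%N -> vol [set (0 : 'rV[R]_k)] = 0%E.
Proof.
move=> k0; rewrite set0_box vol_box//; under eq_bigr do rewrite lebesgue_measure_set1.
by case: k k0 => // k' _; rewrite big_ord_recl mul0e.
Qed.

Lemma vol_ball_lty : (vol (@unit_ball R k) < +oo)%E.
Proof.
apply: le_lt_trans (@vol_cube_lty R k 1); apply: le_measure; rewrite ?inE.
- exact: measurable_unit_ball.
- exact: measurable_cube.
move=> y /= yB i /=; rewrite in_itv/= -ler_norml.
exact: le_trans (ler_coor_enorm _ _) (ltW yB).
Qed.

Lemma vol_ball_gt0 : (0 < vol (@unit_ball R k))%E.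
Proof.
(* The cube of half-side d lies in the open ball because |y|^2 <= k d^2 <= k d < 1; the choice k + 1
   keeps this strict and covers k = 0. *)
pose d : R := k.+1%:R^-1.
have d0 : 0 < d by rewrite invr_gt0.
apply: (@lt_le_trans _ _ (vol (box (fun _ : 'I_k => [set` `]- d, d[])))).
  rewrite vol_box; last by move=> i; exact: measurable_itv.
  have dd : - d < d by rewrite (lt_trans _ d0)// oppr_lt0.
  under eq_bigr do rewrite lebesgue_measure_itv/= lte_fin dd.
  under eq_bigr do rewrite -EFinD.
  by rewrite prodEFin lte_fin prodr_gt0// => i _; rewrite opprK addr_gt0.
apply: le_measure; rewrite ?inE.
- by apply: measurable_box => i; exact: measurable_itv.
- exact: measurable_unit_ball.
move=> y /= yd; rewrite /unit_ball/= /enorm -sqrtr1 ltr_sqrt//.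
apply: (@le_lt_trans _ _ (\sum_(i < k) d)).
  apply: ler_sum => i _; have := yd i; rewrite /= in_itv/= -ltr_norml => /ltW yi.
  apply: (@le_trans _ _ (d ^+ 2)).
    by rewrite -real_normK ?num_real// lerXn2r// nnegrE ltW.
  by rewrite expr2 ler_piMl ?(ltW d0)// /d invf_le1// ler1n.
rewrite sumr_const card_ord -[_ *+ _]mulr_natr mulrC ltr_pdivrMr// mul1r.
by rewrite ltr_nat.
Qed.

Lemma vol_ballE : vol (@unit_ball R k) = (ball_volume R k)%:E.
Proof. by rewrite fineK// ge0_fin_numE// vol_ball_lty. Qed.

Lemma ball_volume_gt0 : 0 < ball_volume R k.
Proof. by rewrite -lte_fin -vol_ballE vol_ball_gt0. Qed.

Lemma integral_ball_cst (c : \bar R) :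
  (\int[@vol R k]_(y in unit_ball) c = c * (ball_volume R k)%:E)%E.
Proof. by rewrite -vol_ballE integral_cst//; exact: measurable_unit_ball. Qed.

End enorm.

(** * Polar coordinates *)

Section tail.
Context {R : realType}.
Local Notation mu := (@lebesgue_measure R).

Lemma powRN_cvg0 (a : R) : 0 < a -> s `^ (- a) @[s --> +oo] --> 0.
Proof.
move=> a0; apply/cvgr0Pnorm_lt => eps eps0; near=> s.
have s0 : 0 < s by near: s; exact: nbhs_pinfty_gt.
have es : eps^-1 `^ a^-1 < s by near: s; exact: nbhs_pinfty_gt.
rewrite ger0_norm ?powR_ge0// powRN invf_plt ?posrE ?powR_gt0//.
rewrite -[ltLHS]powRr1 ?invr_ge0 ?ltW// -(mulVf (lt0r_neq0 a0)) powRrM.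
by rewrite gt0_ltr_powR// ?nnegrE ?powR_ge0 ?ltW.
Unshelve. all: by end_near. Qed.

Lemma integral_powR_tail (a c : R) : 0 < a -> 0 < c ->
  (\int[mu]_s (if (c < s)%R then (s `^ (- a - 1))%:E else 0) =
   (c `^ (- a) / a)%:E)%E.
Proof.
move=> a0 c0.
transitivity (\int[mu]_(s in `]c, +oo[) (s `^ (- a - 1))%:E)%E.
  by symmetry; apply: integral_if => s; rewrite /= in_itv/= andbT.
have dF (p x : R) : 0 < x -> is_derive x 1 (fun s : R => s `^ p) (p * x `^ (p - 1)).
  by move=> x0; exact: is_derive1_powR.
rewrite integral_itv_obnd_cbnd; last first.
  apply/measurable_EFinP; apply: measurable_funTS; exact: measurable_powR.
pose F (s : R) := (- a^-1) * s `^ (- a).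
have dFF (x : R) : 0 < x -> is_derive x 1 F (x `^ (- a - 1)).
  move=> x0; have -> : x `^ (- a - 1) = (- a^-1) *: (- a * x `^ (- a - 1)).
    by rewrite /GRing.scale/= mulrA mulrNN mulVf ?mul1r// gt_eqF.
  exact: is_deriveZ (dF (- a) x x0).
rewrite (@ge0_continuous_FTC2y _ _ F c 0).
- by rewrite -EFinB /F sub0r mulNr opprK mulrC.
- by move=> x _; exact: powR_ge0.
- apply: derivable_within_continuous => x; rewrite in_itv/= andbT => cx.
  by case: (dF (- a - 1) x (lt_le_trans c0 cx)).
- rewrite -(mulr0 (- a^-1)); apply: cvgM; first exact: cvg_cst.
  exact: powRN_cvg0.
- by move=> x cx; case: (dFF x (lt_trans c0 cx)).
- apply: cvg_at_right_filter; apply: differentiable_continuous.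
  by apply/derivable1_diffP; case: (dFF c c0).
- move=> x; rewrite in_itv/= andbT => cx; rewrite derive1E.
  by case: (dFF x (lt_trans c0 cx)).
Qed.

End tail.

Lemma measurable_scale_rV d (T : measurableType d) (R : realType) n
    (f : T -> R) (g : T -> 'rV[R]_n) :
  measurable_fun setT f -> measurable_fun setT g ->
  measurable_fun setT (fun x => f x *: g x).
Proof.
move=> mf mg; apply/measurable_fun_rVP => i.
apply: (eq_measurable_fun (fun x => f x * coor i (g x))).
  by move=> x _; rewrite /coor /= mxE.
by apply: measurable_funM => //; exact: measurableT_comp (measurable_coor i) mg.
Qed.

Lemma measurable_powR_comp d (T : measurableType d) (R : realType)
    (f : T -> R) (p : R) :
  measurable_fun setT f -> measurable_fun setT (fun x => f x `^ p).
Proof. exact: measurableT_comp (measurable_powR p). Qed.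

Lemma measurable_enorm_comp d (T : measurableType d) (R : realType) n
    (g : T -> 'rV[R]_n) :
  measurable_fun setT g -> measurable_fun setT (fun x => enorm (g x)).
Proof. exact: measurableT_comp (@measurable_enorm R n). Qed.

Section polar.
Context (R : realType) (k : nat).
Hypothesis k0 : (0 < k)%N.
Local Notation mu := (@lebesgue_measure R).
Local Notation vol := (@vol R k).
Local Open Scope ereal_scope.

(** The origin, where [radial_proj] takes the default value 0, is deleted as a null set, so that
    later divisions by [enorm y] are legitimate. *)
Lemma integral_ball (G : 'rV[R]_k -> \bar R) :
  measurable_fun setT G -> (forall y, 0 <= G y) ->
  \int[vol]_(y in unit_ball) G y =
  \int[vol]_y (if (0 < enorm y < 1)%R then G y else 0).
Proof.
move=> mG G0; rewrite (ge0_negligible_integral (N := [set (0 : 'rV[R]_k)%R]))//.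
- apply: integral_if => y; split => /= [[y1 /= y0]|/andP[y0 y1]].
    rewrite lt_neqAle enorm_ge0 andbT y1 andbT eq_sym; apply/eqP => /enorm_eq0.
    exact: y0.
  by split => // yE; move: y0; rewrite yE enorm0 ltxx.
- by rewrite set0_box; exact: measurable_box.
- exact: measurable_unit_ball.
- exact: measurable_funTS.
- exact: vol_set0.
Qed.

(* Only linear substitutions are needed: [u = |y|^(1/e) s] for fixed [y], then
   [z = s^e y] for fixed [s], exchanging the integrals in between; what remains
   is the integral of [s^(-ke-1)] over [s > |z|^(1/e)].  The exponent [e] gives
   the radius [u^e] and so also covers the variable [u = |y|^2]. *)
Lemma polar (e : R) (Psi : 'rV[R]_k -> \bar R) : (0 < e)%R ->
  measurable_fun setT Psi -> (forall y, 0 <= Psi y) ->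
  \int[vol]_(y in unit_ball) Psi y =
  (k%:R * e)%:E * \int[mu]_(u in `]0%R, 1%R[) ((u `^ (k%:R * e - 1))%:E *
    \int[vol]_(y in unit_ball) Psi (u `^ e *: radial_proj y)%R).
Proof.
move=> e0 mPsi Psi0; set a := (k%:R * e)%R.
have kR0 : (0 < k%:R :> R)%R by rewrite ltr0n.
have a0 : (0 < a)%R by rewrite mulr_gt0.
have n0 (p q : bool) (z : \bar R) : 0 <= z -> 0 <= (if p then if q then z else 0 else 0).
  by case: p; case: q.
have menorm2 : measurable_fun setT (fun p : R * 'rV[R]_k => enorm p.2).
  exact: measurable_enorm_comp.
have men (w : R) : measurable_fun setT (fun y : 'rV[R]_k => (0 < enorm y < w)%R).
  by apply: measurable_and; apply: measurable_fun_ltr => //; exact: measurable_enorm.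
have men2 : measurable_fun setT (fun p : R * 'rV[R]_k => (0 < enorm p.2 < 1)%R).
  by apply: measurable_and; apply: measurable_fun_ltr.
pose F1 (p : R * 'rV[R]_k) := if (0 < enorm p.2 < 1)%R then
   if (0 < p.1 < 1)%R then (p.1 `^ (a - 1))%:E * Psi (p.1 `^ e *: radial_proj p.2)%R else 0 else 0.
have mF1 : measurable_fun setT F1.
  apply: measurable_fun_ifT => //; apply: measurable_fun_ifT => //.
    by apply: measurable_and; apply: measurable_fun_ltr.
  apply: emeasurable_funM.
    by apply/measurable_EFinP; exact: measurable_powR_comp.
  apply: (measurableT_comp mPsi); apply: measurable_scale_rV.
    exact: measurable_powR_comp.
  exact: (measurableT_comp (@measurable_radial_proj R k)).
have F10 p : 0 <= F1 p by apply: n0; rewrite mule_ge0// lee_fin powR_ge0.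
pose F2 (p : R * 'rV[R]_k) := if (0 < enorm p.2 < 1)%R then
   if (0 < p.1)%R && (enorm (p.1 `^ e *: p.2) < 1)%R then
      (enorm p.2 ^+ k * p.1 `^ (a - 1))%:E * Psi (p.1 `^ e *: p.2)%R else 0 else 0.
have msc : measurable_fun setT (fun p : R * 'rV[R]_k => p.1 `^ e *: p.2)%R.
  by apply: measurable_scale_rV => //; exact: measurable_powR_comp.
have mF2 : measurable_fun setT F2.
  apply: measurable_fun_ifT => //; apply: measurable_fun_ifT => //.
    apply: measurable_and; apply: measurable_fun_ltr => //.
    exact: measurable_enorm_comp.
  apply: emeasurable_funM; last exact: (measurableT_comp mPsi).
  apply/measurable_EFinP; apply: measurable_funM; last exact: measurable_powR_comp.
  exact: measurable_funX.
have F20 p : 0 <= F2 p.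
  by apply: n0; rewrite mule_ge0// lee_fin mulr_ge0 ?powR_ge0 ?exprn_ge0 ?enorm_ge0.
pose F3 (p : R * 'rV[R]_k) := if (0 < enorm p.2 < 1)%R then
   if (0 < p.1)%R && (enorm p.2 < p.1 `^ e)%R then
      (enorm p.2 ^+ k * p.1 `^ (- a - 1))%:E * Psi p.2 else 0 else 0.
have mF3 : measurable_fun setT F3.
  apply: measurable_fun_ifT => //; apply: measurable_fun_ifT => //.
    apply: measurable_and; apply: measurable_fun_ltr => //.
    exact: measurable_powR_comp.
  apply: emeasurable_funM; last exact: (measurableT_comp mPsi).
  apply/measurable_EFinP; apply: measurable_funM; last exact: measurable_powR_comp.
  exact: measurable_funX.
have F30 p : 0 <= F3 p.
  by apply: n0; rewrite mule_ge0// lee_fin mulr_ge0 ?powR_ge0 ?exprn_ge0 ?enorm_ge0.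
have step1 : \int[mu]_(u in `]0%R, 1%R[) ((u `^ (a - 1))%:E *
    \int[vol]_(y in unit_ball) Psi (u `^ e *: radial_proj y)%R) =
  \int[mu]_u \int[vol]_y F1 (u, y).
  transitivity (\int[mu]_u (if (0 < u < 1)%R then (u `^ (a - 1))%:E *
      \int[vol]_(y in unit_ball) Psi (u `^ e *: radial_proj y)%R else 0)).
    by apply: integral_if => u; rewrite /= in_itv.
  apply: eq_integral => u _; rewrite /F1 /=; case: ifPn => u01; last first.
    by rewrite integral0_eq// => y _; case: ifP.
  have mPu : measurable_fun setT (fun y => Psi (u `^ e *: radial_proj y)%R).
    apply: (measurableT_comp mPsi); apply: measurable_scale_rV => //.
    exact: measurable_radial_proj.
  rewrite integral_ball// -ge0_integralZl_EFin ?powR_ge0//.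
  - by apply: eq_integral => y _; case: ifP => //; rewrite mule0.
  - by move=> y _; case: ifP.
  - by apply: measurable_fun_ifT.
have step2 y : \int[mu]_u F1 (u, y) = \int[mu]_s F2 (s, y).
  rewrite /F1 /F2 /=; case: (boolP (0 < enorm y < 1)%R) => [/andP[y0 y1]|_]; last by rewrite !integral0.
  set r := enorm y in y0 y1 *.
  (* With u = c s one has u^e y / |y| = s^e y: the projection disappears and the argument of [Psi]
     becomes linear in y. *)
  pose c := (r `^ e^-1)%R.
  have c0 : (0 < c)%R by rewrite powR_gt0.
  have ce : (c `^ e = r)%R by rewrite /c -powRrM mulVf ?gt_eqF// powRr1// ltW.
  pose H u := if (0 < u < 1)%R then (u `^ (a - 1))%:E * Psi (u `^ e *: radial_proj y)%R else 0.
  have mH : measurable_fun setT H.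
    apply: measurable_fun_ifT => //.
      by apply: measurable_and; apply: measurable_fun_ltr.
    apply: emeasurable_funM; first by apply/measurable_EFinP; exact: measurable_powR_comp.
    by apply: (measurableT_comp mPsi); apply: measurable_scale_rV => //; exact: measurable_powR_comp.
  have H0 u : 0 <= H u by rewrite /H; case: ifP => // _; rewrite mule_ge0// lee_fin powR_ge0.
  transitivity (c%:E * \int[mu]_s H (c * s)%R).
    by rewrite ge0_integral_scale1// muleA -EFinM mulfV ?gt_eqF// mul1e.
  rewrite -ge0_integralZl_EFin ?ltW//; last first.
    by apply: (measurableT_comp mH); exact: measurable_funM.
  apply: eq_integral => s _; rewrite /H pmulr_rgt0//.
  have [s0|] := ltP 0%R s; last by rewrite mule0.
  have cse : ((c * s) `^ e = s `^ e * r)%R by rewrite powRM ?ltW// ce mulrC.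
  rewrite enormZ ger0_norm ?powR_ge0//= -/r -cse.
  have -> : (c * s < 1)%R = ((c * s) `^ e < 1)%R.
    have e1 : (1 `^ e = 1 :> R)%R by rewrite powR1.
    rewrite -[X in _ = (_ < X)%R]e1; apply/esym.
    have [lt|ge] := ltP (c * s)%R 1%R.
      by rewrite gt0_ltr_powR// ?nnegrE// mulr_ge0// ltW.
    by apply/negbTE; rewrite -leNgt ge0_ler_powR// ?nnegrE ?mulr_ge0// ltW.
  case: ifP => _; last by rewrite mule0.
  rewrite muleA -EFinM cse; congr (_%:E * Psi _).
    rewrite powRM ?ltW// mulrA; congr (_ * _)%R.
    rewrite mulr_powRB1 ?(ltW c0)// /c -powRrM /a mulrCA mulVf ?gt_eqF//.
    by rewrite mulr1 powR_mulrn// ltW.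
  by rewrite /radial_proj -/r scalerA mulfK ?gt_eqF.
have step3 s : \int[vol]_y F2 (s, y) = \int[vol]_z F3 (s, z).
  rewrite /F2 /F3 /=; have [s0|_] := ltP 0%R s; last first.
    by apply: eq_integral => y _; case: ifP.
  have se0 : (0 < s `^ e)%R by rewrite powR_gt0.
  have sB p q : (s `^ (p - q) = s `^ p / s `^ q)%R.
    by rewrite powRB// (gt_eqF s0) implybT.
  (* For z = s^e y, |y|^k s^(a-1) = |z|^k s^(-a) s^(a-1) = |z|^k / s, since a = k e. The Jacobian
     s^(-a) will supply the missing power. *)
  pose H z := if (0 < enorm z < s `^ e)%R && (enorm z < 1)%R then
     (s^-1 * enorm z ^+ k)%:E * Psi z else 0.
  have mH : measurable_fun setT H.
    apply: measurable_fun_ifT => //.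
      apply: measurable_and; first exact: men.
      by apply: measurable_fun_ltr => //; exact: measurable_enorm.
    apply: emeasurable_funM => //; apply/measurable_EFinP; apply: measurable_funM => //.
    by apply: measurable_funX; exact: measurable_enorm.
  have H0 z : 0 <= H z.
    rewrite /H; case: ifP => // _; rewrite mule_ge0// lee_fin mulr_ge0//.
      by rewrite invr_ge0 ltW.
    by rewrite exprn_ge0 ?enorm_ge0.
  have sa : ((s `^ e) ^+ k = s `^ a)%R by rewrite -powR_mulrn ?powR_ge0// -powRrM mulrC.
  transitivity (\int[vol]_y H (s `^ e *: y)%R).
    apply: eq_integral => y _; rewrite /H enormZ ger0_norm ?powR_ge0//.
    rewrite pmulr_rgt0// gtr_pMr//; case: ifP => //= _; case: ifP => // _.
    congr (_%:E * _); rewrite exprMn sa mulrA [RHS]mulrC; congr (_ * _)%R.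
    by rewrite sB powRr1 ?ltW// mulrC.
  rewrite ge0_integral_scale// -ge0_integralZl_EFin//; last first.
    by rewrite invr_ge0 exprn_ge0// powR_ge0.
  apply: eq_integral => z _; rewrite /H.
  have [z0|] /= := ltP 0%R (enorm z); last by rewrite mule0.
  case: (enorm z < 1)%R; last by rewrite andbF mule0.
  rewrite andbT; case: ifP => _; last by rewrite mule0.
  rewrite muleA -EFinM. congr (_ * _); congr EFin.
  by rewrite sa sB powRr1 ?ltW// powRN [LHS]mulrA [LHS]mulrC.
have step4 z : \int[mu]_s F3 (s, z) =
    if (0 < enorm z < 1)%R then (a^-1)%:E * Psi z else 0.
  rewrite /F3 /=; case: (boolP (0 < enorm z < 1)%R) => [/andP[z0 _]|_]; last by rewrite integral0.
  (* c is the threshold where s^e = |z|, and c^(-a) = |z|^(-k) cancels the factor |z|^k: the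
     integral over s leaves the constant 1/a. *)
  set r := enorm z in z0 *; pose c := (r `^ e^-1)%R.
  have c0 : (0 < c)%R by rewrite powR_gt0.
  have ce : (c `^ e = r)%R by rewrite /c -powRrM mulVf ?gt_eqF// powRr1// ltW.
  have mt : measurable_fun setT (fun s : R => if (c < s)%R then (s `^ (- a - 1))%:E else 0).
    apply: measurable_fun_ifT => //; first exact: measurable_fun_ltr.
    by apply/measurable_EFinP; exact: measurable_powR_comp.
  have t0 (s : R) : 0 <= (if (c < s)%R then (s `^ (- a - 1))%:E else 0).
    by case: ifP => // _; rewrite lee_fin powR_ge0.
  transitivity (\int[mu]_s ((r ^+ k)%:E * Psi z * (if (c < s)%R then (s `^ (- a - 1))%:E else 0))).
    apply: eq_integral => s _.
    have -> : (0 < s)%R && (r < s `^ e)%R = (c < s)%R.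
      have [s0|s0] /= := ltP 0%R s; last first.
        by apply/esym/negbTE; rewrite -leNgt (le_trans s0)// ltW.
      rewrite -ce; have [lt|ge] := ltP c s.
        by rewrite gt0_ltr_powR// ?nnegrE ltW.
      by apply/negbTE; rewrite -leNgt ge0_ler_powR// ?nnegrE ltW.
    by case: ifP => _; rewrite ?mule0// EFinM muleAC.
  rewrite ge0_integralZl//; last by rewrite mule_ge0// lee_fin exprn_ge0// ltW.
  rewrite integral_powR_tail// muleAC -EFinM; congr (_%:E * _).
  rewrite mulrA (_ : r ^+ k * c `^ (- a) = 1)%R ?mul1r// /c -powRrM.
  rewrite (_ : e^-1 * - a = - k%:R)%R; last by rewrite /a; field; rewrite gt_eqF.
  by rewrite powRN powR_mulrn ?ltW// mulfV// expf_neq0// gt_eqF.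
have tonelli (F : R * 'rV[R]_k -> \bar R) : measurable_fun setT F ->
    (forall p, 0 <= F p) ->
    \int[mu]_u \int[vol]_y F (u, y) = \int[vol]_y \int[mu]_u F (u, y).
  by move=> mF F0; exact: (@fubini_tonelli _ _ _ _ _ mu vol F).
rewrite step1 (tonelli F1)//; under [in RHS]eq_integral do rewrite step2.
rewrite -(tonelli F2)//; under [in RHS]eq_integral do rewrite step3.
rewrite (tonelli F3)//; under [in RHS]eq_integral do rewrite step4.
rewrite integral_ball// -ge0_integralZl_EFin ?ltW//.
- apply: eq_integral => y _; case: ifP => _; last by rewrite mule0.
  by rewrite muleA -EFinM mulfV ?gt_eqF// mul1e.
- by move=> y _; case: ifP => // _; rewrite mule_ge0// lee_fin invr_ge0 ltW.
- by apply: measurable_fun_ifT => //; exact: measurable_funeM.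
Qed.

End polar.

Section radial.
Context (R : realType) (k : nat).
Hypothesis k0 : (0 < k)%N.
Local Notation mu := (@lebesgue_measure R).
Local Notation vol := (@vol R k).
Local Open Scope ereal_scope.

Lemma polar_radial (e : R) (h : R -> \bar R) : (0 < e)%R ->
  measurable_fun setT h -> (forall r, 0 <= h r) ->
  \int[vol]_(y in unit_ball) h (enorm y) =
  (k%:R * e * ball_volume R k)%:E *
    \int[mu]_(u in `]0%R, 1%R[) ((u `^ (k%:R * e - 1))%:E * h (u `^ e)%R).
Proof.
move=> e0 mh h0; rewrite (polar k0 e0)//; last first.
  by apply: (measurableT_comp mh); exact: measurable_enorm.
rewrite [X in _ = X * _]EFinM -muleA; congr (_ * _).
have mI : measurable (`]0%R, 1%R[%classic : set R) by exact: measurable_itv.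
have mp (p : R) : measurable_fun setT (fun u : R => (u `^ p)%:E).
  by apply/measurable_EFinP; exact: measurable_powR_comp.
rewrite -ge0_integralZl//; last 3 first.
- apply: measurable_funTS; apply: emeasurable_funM; first exact: mp.
  by apply: (measurableT_comp mh); exact: measurable_powR_comp.
- by move=> u _; rewrite mule_ge0// lee_fin powR_ge0.
- by rewrite lee_fin ltW// ball_volume_gt0.
apply: eq_integral => u /set_mem; rewrite /= in_itv/= => /andP[u0 u1].
rewrite muleCA; congr (_ * _).
rewrite integral_ball//; last first.
  apply: (measurableT_comp mh); apply: measurable_enorm_comp.
  by apply: measurable_scale_rV => //; exact: measurable_radial_proj.
transitivity (\int[vol]_(y in unit_ball) h (u `^ e)%R).
  rewrite integral_ball//; apply: eq_integral => y _; case: ifP => // /andP[y0 _].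
  rewrite enormZ /radial_proj enormZ ger0_norm ?powR_ge0// ger0_norm ?invr_ge0 ?ltW//.
  by rewrite mulVf ?mulr1// gt_eqF.
by rewrite integral_ball_cst muleC.
Qed.

End radial.

Section one_dim.
Context {R : realType}.
Local Notation mu := (@lebesgue_measure R).
Local Open Scope ereal_scope.

Let mI : measurable (`]0%R, 1%R[%classic : set R).
Proof. exact: measurable_itv. Qed.

(* [polar_radial] for [h = 1] in dimension one. *)
Lemma integral_powR01 (b : R) : (0 < b)%R ->
  \int[mu]_(u in `]0%R, 1%R[) (u `^ (b - 1))%:E = (b^-1)%:E.
Proof.
move=> b0.
have := @polar_radial R 1 isT b (cst 1) b0 (measurable_cst _) (fun=> lee01).
rewrite integral_ball_cst mul1e mul1r.
under eq_integral do rewrite mule1.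
set J := \int[mu]_(_ in _) _; set v := ball_volume R 1.
have v0 : (v != 0)%R by rewrite gt_eqF// ball_volume_gt0.
move/(congr1 (fun z => (v^-1 * b^-1)%:E * z)).
rewrite muleA -!EFinM (_ : _ * (b * v) = 1)%R; last by field; rewrite v0 gt_eqF.
by rewrite mul1e => <-; congr EFin; field; rewrite v0 gt_eqF.
Qed.

(* Comparing [polar_radial] in dimension two for [e = 1] and [e = 1/2] gives the
   substitution [u = s^2] for measurable integrands. *)
Lemma integral_sqr01 (H : R -> \bar R) :
  measurable_fun setT H -> (forall u, 0 <= H u) ->
  \int[mu]_(s in `]0%R, 1%R[) ((2 * s)%:E * H (s ^+ 2)%R) =
  \int[mu]_(u in `]0%R, 1%R[) H u.
Proof.
move=> mH H0.
have mH2 : measurable_fun setT (fun r : R => H (r ^+ 2)%R).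
  by apply: (measurableT_comp mH); exact: measurable_funX.
set v := ball_volume R 2; have v0 : (v != 0)%R by rewrite gt_eqF// ball_volume_gt0.
have h1 := @polar_radial R 2 isT 1 _ ltr01 mH2 (fun=> H0 _).
have e0 : (0 < 2^-1 :> R)%R by rewrite invr_gt0.
have := @polar_radial R 2 isT _ _ e0 mH2 (fun=> H0 _).
rewrite h1 -/v mulr1 mulfV// mul1r subrr.
have -> : \int[mu]_(u in `]0%R, 1%R[) ((u `^ 0)%:E * H (u `^ 2^-1 ^+ 2)%R) =
    \int[mu]_(u in `]0%R, 1%R[) H u.
  apply: eq_integral => u /set_mem; rewrite /= in_itv/= => /andP[u0 u1].
  by rewrite powRr0 mul1e -powR_mulrn ?powR_ge0// -powRrM mulVf// powRr1// ltW.
move/(congr1 (fun z => v^-1%:E * z)).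
rewrite !muleA -!EFinM mulrCA mulVf// mulr1 mul1e => <-.
rewrite -ge0_integralZl//.
- apply: eq_integral => u /set_mem; rewrite /= in_itv/= => /andP[u0 u1].
  rewrite muleA -EFinM (_ : 2 - 1 = 1)%R; last by lra.
  by rewrite !powRr1// ltW.
- apply: measurable_funTS; apply: emeasurable_funM.
    by apply/measurable_EFinP; exact: measurable_powR_comp.
  by apply: (measurableT_comp mH2); exact: measurable_powR_comp.
- by move=> u _; rewrite mule_ge0// lee_fin powR_ge0.
Qed.
End one_dim.

(** * Beta integrals and the mass of the weights *)

Section beta.
Context {R : realType}.
Local Notation mu := (@lebesgue_measure R).
Local Open Scope ereal_scope.

Lemma integral_onem01 (f : R -> \bar R) :
  measurable_fun setT f -> (forall u, 0 <= f u) ->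
  \int[mu]_(t in `]0%R, 1%R[) f (1 - t)%R = \int[mu]_(t in `]0%R, 1%R[) f t.
Proof.
move=> mf f0; pose H (t : R) := if (0 < t < 1)%R then f t else 0.
have HE : \int[mu]_(t in `]0%R, 1%R[) f t = \int[mu]_t H t.
  by apply: integral_if => t; rewrite /= in_itv.
rewrite HE; transitivity (\int[mu]_t H (1 + (-1) * t)%R).
  transitivity (\int[mu]_t (if (0 < t < 1)%R then f (1 - t)%R else 0)).
    by apply: integral_if => t; rewrite /= in_itv.
  apply: eq_integral => t _; rewrite /H mulN1r.
  by congr (if _ then _ else _); apply/idP/idP => /andP[? ?]; apply/andP; split; lra.
rewrite ge0_integral_affine1//.
- by rewrite normrN1 invr1 mul1e.
- apply: measurable_fun_ifT => //.
  by apply: measurable_and; apply: measurable_fun_ltr.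
- by move=> t; rewrite /H; case: ifP.
Qed.

(** The extended-real integral of which [euler_beta] takes the finite part; identities can be stated
    with it before finiteness is known. *)
Definition beta_int (a b : R) : \bar R :=
  \int[mu]_(t in `]0%R, 1%R[) (t `^ (a - 1) * (1 - t) `^ (b - 1))%:E.

Lemma measurable_beta (a b : R) :
  measurable_fun setT (fun t : R => (t `^ (a - 1) * (1 - t) `^ (b - 1))%:E).
Proof.
apply/measurable_EFinP; apply: measurable_funM; apply: measurable_powR_comp => //.
exact: measurable_funB.
Qed.

(** Let A and B be the two powers in the integrand. Since t + (1 - t) = 1, AB = A ((1 - t) B) + (t
    A) B, where (1 - t) B = (1 - t)^b <= 1 and t A = t^a <= 1. So AB <= A + B, and both powers are
    integrable. *)
Lemma beta_int_lty (a b : R) : (0 < a)%R -> (0 < b)%R -> beta_int a b < +oo.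
Proof.
move=> a0 b0.
have mp (p : R) : measurable_fun setT (fun t : R => (t `^ p)%:E).
  by apply/measurable_EFinP; exact: measurable_powR_comp.
have mq (p : R) : measurable_fun setT (fun t : R => ((1 - t) `^ p)%:E).
  by apply/measurable_EFinP; apply: measurable_powR_comp; exact: measurable_funB.
apply: (@le_lt_trans _ _ (\int[mu]_(t in `]0%R, 1%R[)
    ((t `^ (a - 1))%:E + ((1 - t) `^ (b - 1))%:E))).
  apply: ge0_le_integral => //.
  - by move=> t _; rewrite lee_fin mulr_ge0 ?powR_ge0.
  - by apply: measurable_funTS; exact: measurable_beta.
  - by apply: measurable_funTS; apply: emeasurable_funD; [exact: mp|exact: mq].
  move=> t; rewrite /= in_itv/= => /andP[t0 t1]; rewrite -EFinD lee_fin.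
  have s0 : (0 < 1 - t)%R by lra.
  have ta : (t * t `^ (a - 1) <= 1)%R.
    rewrite mulr_powRB1 ?(ltW t0)//.
    have e1 : (1 `^ a = 1 :> R)%R by rewrite powR1.
    by rewrite -[leRHS]e1 ge0_ler_powR ?nnegrE; lra.
  have sb : ((1 - t) * (1 - t) `^ (b - 1) <= 1)%R.
    rewrite mulr_powRB1 ?(ltW s0)//.
    have e1 : (1 `^ b = 1 :> R)%R by rewrite powR1.
    by rewrite -[leRHS]e1 ge0_ler_powR ?nnegrE; lra.
  have A0 := powR_ge0 t (a - 1); have B0 := powR_ge0 (1 - t) (b - 1).
  set A := (t `^ _)%R in ta A0 *; set B := ((1 - t) `^ _)%R in sb B0 *.
  have -> : (A * B = A * ((1 - t) * B) + (t * A) * B)%R by ring.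
  by rewrite lerD// ?ler_piMr// ler_piMl.
rewrite ge0_integralD//.
- have p0 (t : R) : 0 <= (t `^ (b - 1))%:E by rewrite lee_fin powR_ge0.
  rewrite (integral_onem01 (mp (b - 1)%R) p0).
  by rewrite !integral_powR01// -EFinD ltry.
- by move=> t _; rewrite lee_fin powR_ge0.
- by apply: measurable_funTS; exact: mp.
- by move=> t _; rewrite lee_fin powR_ge0.
- by apply: measurable_funTS; exact: mq.
Qed.

Lemma beta_int_ge0 (a b : R) : 0 <= beta_int a b.
Proof. by apply: integral_ge0 => t _; rewrite lee_fin mulr_ge0 ?powR_ge0. Qed.

Lemma beta_intE (a b : R) : (0 < a)%R -> (0 < b)%R ->
  beta_int a b = (euler_beta a b)%:E.
Proof. by move=> a0 b0; rewrite fineK// ge0_fin_numE ?beta_int_ge0// beta_int_lty. Qed.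

(** Neither power has a positive exponent, so the integrand is at least 1. The positivity obtained
    lets the factor B(1 - alpha, alpha) be cancelled in [ball_int_le_weighted]. *)
Lemma beta_int_ge1 (a b : R) : (a <= 1)%R -> (b <= 1)%R -> 1 <= beta_int a b.
Proof.
move=> a1 b1.
have <- : \int[mu]_(t in `]0%R, 1%R[) (cst 1 t) = 1.
  have I1 : mu (`]0%R, 1%R[%classic : set R) = 1.
    by rewrite lebesgue_measure_itv/= lte_fin ltr01 oppr0 adde0.
  by rewrite integral_cst ?mul1e//; exact: measurable_itv.
apply: ge0_le_integral => //.
- by apply: measurable_funTS; exact: measurable_beta.
move=> t; rewrite /= in_itv/= => /andP[t0 t1]; rewrite lee_fin.
have pw (s p : R) : (0 < s < 1)%R -> (p <= 0)%R -> (1 <= s `^ p)%R.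
  move=> /andP[s0 s1] p0; rewrite -(powRr0 s); apply: ger_powR => //.
  by rewrite s0 ltW.
by rewrite -[leLHS]mulr1 ler_pM// pw//; lra.
Qed.

End beta.

Section ball_weight.
Context (R : realType) (k : nat).
Hypothesis k0 : (0 < k)%N.
Local Notation mu := (@lebesgue_measure R).
Local Notation vol := (@vol R k).
Local Open Scope ereal_scope.

Definition ball_weight (alpha : R) : \bar R :=
  \int[vol]_(y in unit_ball) ((1 - enorm y ^+ 2) `^ (- alpha))%:E.

Lemma measurable_weight (alpha : R) :
  measurable_fun setT (fun r : R => ((1 - r ^+ 2) `^ (- alpha))%:E).
Proof.
apply/measurable_EFinP; apply: measurable_powR_comp.
by apply: measurable_funB => //; exact: measurable_funX.
Qed.

(** The exponent e = 1/2 makes u = |y|^2 the variable, and the integrand becomes the beta integrand.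
    As omega_(k-1) = k v_k, the value is the inverse of the normalizing constant in [Smax_alpha]. *)
Lemma ball_weight_beta (alpha : R) : (alpha < 1)%R ->
  ball_weight alpha =
  (k%:R / 2 * ball_volume R k * euler_beta (k%:R / 2) (1 - alpha))%:E.
Proof.
move=> a1; have k2 : (0 < k%:R / 2 :> R)%R by rewrite divr_gt0// ltr0n.
have e0 : (0 < 2^-1 :> R)%R by rewrite invr_gt0.
rewrite [RHS]EFinM -beta_intE ?subr_gt0//.
have := polar_radial k0 e0 (measurable_weight alpha) (fun=> _).
rewrite /ball_weight => ->; last by move=> r; rewrite lee_fin powR_ge0.
congr (_ * _); apply: eq_integral => u /set_mem.
rewrite /= in_itv/= => /andP[u0 u1].
rewrite -EFinM -powR_mulrn ?powR_ge0// -powRrM mulVf// powRr1 ?ltW//.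
by congr (_ * _ `^ _)%:E; rewrite addrAC subrr sub0r.
Qed.

(* Radius [u^(1/k)]: then [1 - u^(2/k) <= 1 - u] since [k >= 2]. *)
Lemma ball_weight_ge (alpha : R) : (1 < k)%N -> (0 < alpha < 1)%R ->
  (ball_volume R k / (1 - alpha))%:E <= ball_weight alpha.
Proof.
move=> k1 /andP[a0 a1].
have kR : (0 < k%:R :> R)%R by rewrite ltr0n.
have e0 : (0 < k%:R^-1 :> R)%R by rewrite invr_gt0.
have := polar_radial k0 e0 (measurable_weight alpha) (fun=> _).
rewrite /ball_weight => ->; last by move=> r; rewrite lee_fin powR_ge0.
rewrite mulfV ?gt_eqF// mul1r subrr EFinM.
apply: lee_wpmul2l; first by rewrite lee_fin ltW// ball_volume_gt0.
rewrite -integral_powR01 ?subr_gt0//.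
have mp (p : R) : measurable_fun setT (fun t : R => (t `^ p)%:E).
  by apply/measurable_EFinP; exact: measurable_powR_comp.
have p0 (t : R) : 0 <= (t `^ (1 - alpha - 1))%:E by rewrite lee_fin powR_ge0.
rewrite -(integral_onem01 (mp _) p0).
apply: ge0_le_integral => //.
- apply: measurable_funTS.
  by apply: (measurableT_comp (mp _)); exact: measurable_funB.
- apply: measurable_funTS; apply: emeasurable_funM; first exact: mp.
  by apply: (measurableT_comp (measurable_weight _)); exact: measurable_powR_comp.
move=> u; rewrite /= in_itv/= => /andP[u0 u1].
rewrite powRr0 mul1e lee_fin addrAC subrr sub0r.
have u2 : (u <= (u `^ k%:R^-1) ^+ 2)%R.
  rewrite -powR_mulrn ?powR_ge0// -powRrM -[leLHS]powRr1 ?(ltW u0)//.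
  apply: ger_powR; first by rewrite u0 ltW.
  by rewrite mulrC ler_pdivrMr// mul1r ler_nat.
have u3 : ((u `^ k%:R^-1) ^+ 2 < 1)%R.
  rewrite expr_lt1// ?powR_ge0//.
  have e1 : (1 `^ k%:R^-1 = 1 :> R)%R by rewrite powR1.
  by rewrite -[ltRHS]e1 gt0_ltr_powR// ?nnegrE ltW.
rewrite !powRN lef_pV2 ?posrE ?powR_gt0//; [|lra|lra].
by rewrite ge0_ler_powR ?nnegrE; lra.
Qed.

End ball_weight.

Lemma ae_scale (R : realType) (P : R -> Prop) (t : R) : 0 < t ->
  {ae (@lebesgue_measure R), forall s, 0 < s -> P s} ->
  {ae (@lebesgue_measure R), forall r, 0 < r -> P (t * r)}.
Proof.
move=> t0 [N [mN N0 PN]].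
have mN' : measurable ((fun s : R => (0 + t * s)%R) @^-1` N).
  by rewrite -[X in measurable X]setTI; exact: measurable_affine.
exists ((fun s : R => (0 + t * s)%R) @^-1` N); split => //.
  rewrite [LHS](lebesgue_measure_affine 0 _ mN) ?gt_eqF// [X in (_ * X)%E]N0.
  by rewrite mule0.
move=> r /= nP; apply: PN => /= h; apply: nP => r0.
by have := h; rewrite add0r; apply; rewrite mulr_gt0.
Qed.

(** * Averages over balls and spheres *)

(** Up to a constant, the density of the radius |y| under the weight (1-|y|^2)^(-alpha). *)
Definition polar_density (R : realType) (k : nat) (alpha r : R) : R :=
  r `^ (k%:R - 1) * (1 - r ^+ 2) `^ (- alpha).

Section averages.
Context (R : realType) (k : nat).
Hypothesis k0 : (0 < k)%N.
Local Notation mu := (@lebesgue_measure R).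
Local Notation vol := (@vol R k).
Local Open Scope ereal_scope.
Implicit Types (Phi : 'rV[R]_k -> \bar R) (alpha t : R) (C : \bar R).

Definition ball_int Phi t : \bar R := \int[vol]_(y in unit_ball) Phi (t *: y)%R.

Definition weighted_int alpha Phi t : \bar R :=
  \int[vol]_(y in unit_ball)
    (((1 - enorm y ^+ 2) `^ (- alpha))%:E * Phi (t *: y)%R).

(* Up to the factor [k], the integral of [Phi (t *: _)] over the unit sphere. *)
Definition sphere_int Phi t : \bar R :=
  \int[vol]_(y in unit_ball) Phi (t *: radial_proj y)%R.

Lemma polar_density_ge0 alpha r : (0 <= polar_density k alpha r)%R.
Proof. by rewrite mulr_ge0 ?powR_ge0. Qed.

Lemma measurable_polar_density alpha :
  measurable_fun setT (EFin \o polar_density k alpha).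
Proof.
apply/measurable_EFinP; apply: measurable_funM; apply: measurable_powR_comp => //.
by apply: measurable_funB => //; exact: measurable_funX.
Qed.

Lemma ball_weight_polar alpha : ball_weight k alpha =
  (k%:R * ball_volume R k)%:E *
    \int[mu]_(r in `]0%R, 1%R[) (polar_density k alpha r)%:E.
Proof.
rewrite /ball_weight (polar_radial k0 (@ltr01 R) (measurable_weight alpha)).
  rewrite mulr1; congr (_ * _); apply: eq_integral => r /set_mem.
  by rewrite /= in_itv/= => /andP[r0 _]; rewrite powRr1 ?(ltW r0).
by move=> r; rewrite lee_fin powR_ge0.
Qed.

Variable Phi : 'rV[R]_k -> \bar R.
Hypotheses (mPhi : measurable_fun setT Phi) (Phi0 : forall y, 0 <= Phi y).

Lemma ball_int_ge0 t : 0 <= ball_int Phi t.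
Proof. exact: integral_ge0. Qed.

Lemma weighted_int_ge0 alpha t : 0 <= weighted_int alpha Phi t.
Proof. by apply: integral_ge0 => y _; rewrite mule_ge0// lee_fin powR_ge0. Qed.

Lemma sphere_int_ge0 t : 0 <= sphere_int Phi t.
Proof. exact: integral_ge0. Qed.

Let mPhit t : measurable_fun setT (fun y : 'rV[R]_k => Phi (t *: y)%R).
Proof. by apply: (measurableT_comp mPhi); exact: measurable_scale_rV. Qed.

Let mw alpha : measurable_fun setT
  (fun y : 'rV[R]_k => ((1 - enorm y ^+ 2) `^ (- alpha))%:E).
Proof.
by apply: (measurableT_comp (measurable_weight alpha)); exact: measurable_enorm.
Qed.

Lemma measurable_sphere_int : measurable_fun setT (sphere_int Phi).
Proof.
pose F (p : R * 'rV[R]_k) :=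
  if (enorm p.2 < 1)%R then Phi (p.1 *: radial_proj p.2)%R else 0.
have mF : measurable_fun setT F.
  apply: measurable_fun_ifT => //.
    by apply: measurable_fun_ltr => //; exact: measurable_enorm_comp.
  apply: (measurableT_comp mPhi); apply: measurable_scale_rV => //.
  exact: (measurableT_comp (@measurable_radial_proj R k)).
have F0 p : 0 <= F p by rewrite /F; case: ifP.
apply: (eq_measurable_fun (fun t => \int[vol]_y F (t, y))).
  by move=> t _; apply/esym; exact: integral_if.
exact: (@measurable_fun_fubini_tonelli_F _ _ _ _ _ vol F mF F0).
Qed.

Lemma measurable_weighted_int alpha : measurable_fun setT (weighted_int alpha Phi).
Proof.
pose F (p : R * 'rV[R]_k) :=
  if (enorm p.2 < 1)%R then
    ((1 - enorm p.2 ^+ 2) `^ (- alpha))%:E * Phi (p.1 *: p.2)%R else 0.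
have mF : measurable_fun setT F.
  apply: measurable_fun_ifT => //.
    by apply: measurable_fun_ltr => //; exact: measurable_enorm_comp.
  apply: emeasurable_funM; first exact: (measurableT_comp (mw alpha)).
  by apply: (measurableT_comp mPhi); apply: measurable_scale_rV.
have F0 p : 0 <= F p.
  by rewrite /F; case: ifP => // _; rewrite mule_ge0// lee_fin powR_ge0.
apply: (eq_measurable_fun (fun t => \int[vol]_y F (t, y))).
  by move=> t _; apply/esym; exact: integral_if.
exact: (@measurable_fun_fubini_tonelli_F _ _ _ _ _ vol F mF F0).
Qed.

Lemma weighted_int_polar alpha t :
  weighted_int alpha Phi t = k%:R%:E *
    \int[mu]_(r in `]0%R, 1%R[)
      ((polar_density k alpha r)%:E * sphere_int Phi (t * r)).
Proof.
rewrite /weighted_int (polar k0 (@ltr01 R)); last 2 first.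
- exact: emeasurable_funM.
- by move=> y; rewrite mule_ge0// lee_fin powR_ge0.
rewrite mulr1; congr (_ * _); apply: eq_integral => r /set_mem.
rewrite /= in_itv/= => /andP[r0 r1]; rewrite /polar_density EFinM -muleA; congr (_ * _).
rewrite powRr1 ?(ltW r0)//.
have mrad (s : R) : measurable_fun setT (fun y : 'rV[R]_k => s *: radial_proj y)%R.
  by apply: measurable_scale_rV => //; exact: measurable_radial_proj.
have mS : measurable_fun setT (fun y : 'rV[R]_k => Phi (t * r *: radial_proj y)%R).
  exact: (measurableT_comp mPhi).
rewrite integral_ball//; last 2 first.
- apply: emeasurable_funM; first exact: (measurableT_comp (mw alpha)).
  exact: (measurableT_comp (mPhit t)).
- by move=> y; rewrite mule_ge0// lee_fin powR_ge0.
rewrite [X in _ = _ * X]integral_ball// -ge0_integralZl_EFin ?powR_ge0//; last 2 first.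
- by move=> y _; case: ifP.
- apply: measurable_fun_ifT => //.
  by apply: measurable_and; apply: measurable_fun_ltr => //; exact: measurable_enorm.
apply: eq_integral => y _; case: ifP; last by rewrite mule0.
move=> /andP[y0 _]; rewrite scalerA; congr (((1 - _ ^+ 2) `^ _)%:E * _).
rewrite enormZ /radial_proj enormZ ger0_norm ?(ltW r0)//.
by rewrite ger0_norm ?invr_ge0 ?(ltW y0)// mulVf ?mulr1// gt_eqF.
Qed.

(** In polar form both sides are integrals against [polar_density], and an a.e. bound in s remains
    an a.e. bound in r after s = t r. Nothing is divided out, so [C] may be infinite. *)
Lemma weighted_int_le_sphere alpha t C : 0 <= C -> (0 < t)%R ->
  {ae mu, forall s, (0 < s)%R -> sphere_int Phi s <= C} ->
  (ball_volume R k)%:E * weighted_int alpha Phi t <= C * ball_weight k alpha.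
Proof.
move=> C0 t0 SC; have bv0 := ball_volume_gt0 R k.
have w0 (r : R) : 0 <= (polar_density k alpha r)%:E.
  by rewrite lee_fin polar_density_ge0.
have mW := measurable_polar_density alpha.
have mI : measurable (`]0%R, 1%R[%classic : set R) by exact: measurable_itv.
rewrite ball_weight_polar weighted_int_polar muleA -EFinM [X in _ <= X]muleCA mulrC.
apply: lee_wpmul2l; first by rewrite lee_fin mulr_ge0// ltW.
rewrite muleC -ge0_integralZr//; last exact: measurable_funTS.
apply: ae_ge0_le_integral => //.
- by move=> r _; rewrite mule_ge0// sphere_int_ge0.
- apply: measurable_funTS; apply: emeasurable_funM => //.
  apply: (measurableT_comp measurable_sphere_int).
  exact: measurable_funM.
- by move=> r _; rewrite mule_ge0.
- by apply: measurable_funTS; exact: emeasurable_funM.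
have [N [mN N0 PN]] := ae_scale t0 SC.
exists N; split => // r /= nr; apply: PN => /= SCr; apply: nr.
rewrite in_itv/= => /andP[r0 _]; apply: lee_wpmul2l; first exact: w0.
exact: SCr.
Qed.

End averages.

(** * Uniform ball averages as mixtures of weighted ones *)

Section mixture.
Context (R : realType) (k : nat).
Hypothesis k0 : (0 < k)%N.
Local Notation mu := (@lebesgue_measure R).
Local Notation vol := (@vol R k).
Local Open Scope ereal_scope.

(** Put u = s^2, then u = rho^2 + c v with c = 1 - rho^2. The powers of c are c (from du),
    c^(alpha-1) and c^(-alpha), with product 1, so the value does not depend on rho. This
    independence is why the mixture is uniform on the ball. *)
Lemma beta_kernel (alpha rho : R) : (0 < alpha < 1)%R -> (0 <= rho < 1)%R ->
  \int[mu]_s (if (rho < s < 1)%R then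
    (s * (1 - s ^+ 2) `^ (alpha - 1) * (s ^+ 2 - rho ^+ 2) `^ (- alpha))%:E
    else 0) = (2^-1)%:E * beta_int (1 - alpha) alpha.
Proof.
move=> /andP[a0 a1] /andP[r0 r1].
pose c := (1 - rho ^+ 2)%R.
have c0 : (0 < c)%R by rewrite subr_gt0 expr_lt1.
pose H (u : R) := if (rho ^+ 2 < u < 1)%R then
  ((1 - u) `^ (alpha - 1) * (u - rho ^+ 2) `^ (- alpha))%:E else 0.
have mH : measurable_fun setT H.
  apply: measurable_fun_ifT => //.
    by apply: measurable_and; apply: measurable_fun_ltr.
  apply/measurable_EFinP; apply: measurable_funM;
    apply: measurable_powR_comp; exact: measurable_funB.
have H0 u : 0 <= H u.
  by rewrite /H; case: ifP => // _; rewrite lee_fin mulr_ge0 ?powR_ge0.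
have HI : \int[mu]_(u in `]0%R, 1%R[) H u = beta_int (1 - alpha) alpha.
  transitivity (\int[mu]_u H u).
    transitivity (\int[mu]_u (if (0 < u < 1)%R then H u else 0)).
      by apply: integral_if => u; rewrite /= in_itv.
    apply: eq_integral => u _; case: ifP => //; rewrite /H.
    case: ifP => // /andP[u0 u1]; rewrite u1 andbT => /negP[].
    by rewrite (le_lt_trans _ u0)// sqr_ge0.
  transitivity (c%:E * \int[mu]_v H (rho ^+ 2 + c * v)%R).
    rewrite ge0_integral_affine1 ?gt_eqF// gtr0_norm// muleA -EFinM.
    by rewrite mulfV ?mul1e// gt_eqF.
  rewrite -ge0_integralZl_EFin//; last 2 first.
  - by apply: (measurableT_comp mH); exact: measurable_affine.
  - exact: ltW.
  rewrite [RHS](_ : _ = \int[mu]_v (if (0 < v < 1)%R then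
      (v `^ (1 - alpha - 1) * (1 - v) `^ (alpha - 1))%:E else 0)); last first.
    by apply: integral_if => u; rewrite /= in_itv.
  apply: eq_integral => v _; rewrite /H.
  have -> : (rho ^+ 2 < rho ^+ 2 + c * v < 1)%R = (0 < v < 1)%R.
    rewrite ltrDl pmulr_rgt0//; congr (_ && _).
    by rewrite -ltrBrDl -/c gtr_pMr.
  case: ifPn => [/andP[v0 v1]|_]; last by rewrite mule0.
  rewrite -EFinM; congr EFin.
  have -> : (1 - (rho ^+ 2 + c * v) = c * (1 - v))%R by rewrite /c; ring.
  rewrite addrAC subrr add0r (addrAC 1%R) subrr sub0r.
  rewrite !powRM ?(ltW c0) ?(ltW v0)//; last by lra.
  have cE : (c * (c `^ (alpha - 1) * c `^ (- alpha)) = 1)%R.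
    rewrite -powRD; last by rewrite (gt_eqF c0) implybT.
    rewrite (_ : alpha - 1 + - alpha = -1)%R; last by ring.
    by rewrite powR_inv1 ?mulfV ?gt_eqF// ltW.
  set A := (c `^ (alpha - 1))%R in cE *; set B := (c `^ (- alpha))%R in cE *.
  set X := ((1 - v) `^ _)%R; set Y := (v `^ _)%R.
  by rewrite -[RHS]mul1r -cE; ring.
rewrite -HI -integral_sqr01//.
rewrite -ge0_integralZl_EFin//; last 2 first.
- by move=> s; rewrite /= in_itv/= => /andP[s0 _]; rewrite mule_ge0// lee_fin mulr_ge0// ltW.
- apply: measurable_funTS; apply: emeasurable_funM.
    by apply/measurable_EFinP; exact: measurable_funM.
  by apply: (measurableT_comp mH); exact: measurable_funX.
rewrite [RHS](_ : _ = \int[mu]_s (if (0 < s < 1)%R then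
   (2^-1)%:E * ((2 * s)%:E * H (s ^+ 2)%R) else 0)); last first.
  by apply: integral_if => s; rewrite /= in_itv.
apply: eq_integral => s _; rewrite /H.
have [s0|s0] := ltP 0%R s; last first.
  by rewrite [(rho < s)%R]ltNge (le_trans s0 r0).
rewrite ltr_pXn2r ?nnegrE ?(ltW s0)// expr_lt1 ?(ltW s0)//=.
case: (s < 1)%R; last by rewrite andbF.
have [rs /=|_] := ltP rho s; last by rewrite /= !mule0.
by rewrite -!EFinM; congr EFin; rewrite !mulrA mulVf// mul1r.
Qed.

Variable Phi : 'rV[R]_k -> \bar R.
Hypotheses (mPhi : measurable_fun setT Phi) (Phi0 : forall y, 0 <= Phi y).

(* If [rho] is radial for the weight [(1-|y|^2)^(-alpha)] and [s] has this density
   (both up to normalization) and is independent of it, then [s rho] is the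
   radius of a uniform point of the ball: for the squares this is the product
   rule Beta(k/2, 1-alpha) Beta(k/2+1-alpha, alpha) = Beta(k/2, 1). *)
Definition mixing_density alpha (s : R) : R :=
  s `^ (k%:R + 1 - 2 * alpha) * (1 - s ^+ 2) `^ (alpha - 1).

Lemma mixing_density_ge0 alpha s : (0 <= mixing_density alpha s)%R.
Proof. by rewrite mulr_ge0 ?powR_ge0. Qed.

Lemma measurable_mixing_density alpha :
  measurable_fun setT (EFin \o mixing_density alpha).
Proof.
apply/measurable_EFinP; apply: measurable_funM; apply: measurable_powR_comp => //.
by apply: measurable_funB => //; exact: measurable_funX.
Qed.

Lemma mixing_weighted_int (alpha t : R) : (0 < alpha < 1)%R ->
  \int[mu]_(s in `]0%R, 1%R[)
    ((mixing_density alpha s)%:E * weighted_int alpha Phi (t * s)) =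
  (2^-1)%:E * beta_int (1 - alpha) alpha * ball_int Phi t.
Proof.
move=> a01.
have mPt (s : R) : measurable_fun setT (fun y : 'rV[R]_k => Phi (s *: y)%R).
  by apply: (measurableT_comp mPhi); exact: measurable_scale_rV.
pose K (r s : R) := (s * (1 - s ^+ 2) `^ (alpha - 1) *
  (s ^+ 2 - r ^+ 2) `^ (- alpha))%R.
have K0 r s : (0 < s)%R -> (0 <= K r s)%R.
  by move=> s0; rewrite !mulr_ge0 ?powR_ge0// ltW.
pose F (p : R * 'rV[R]_k) := if (0 < enorm p.2 < 1)%R then
  if (enorm p.2 < p.1 < 1)%R then (K (enorm p.2) p.1)%:E * Phi (t *: p.2)%R else 0 else 0.
have men2 : measurable_fun setT (fun p : R * 'rV[R]_k => enorm p.2).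
  exact: measurable_enorm_comp.
have mF : measurable_fun setT F.
  apply: measurable_fun_ifT => //.
    by apply: measurable_and; apply: measurable_fun_ltr.
  apply: measurable_fun_ifT => //.
    by apply: measurable_and; apply: measurable_fun_ltr.
  apply: emeasurable_funM; last exact: (measurableT_comp (mPt t)).
  apply/measurable_EFinP; apply: measurable_funM.
    apply: measurable_funM => //; apply: measurable_powR_comp.
    by apply: measurable_funB => //; exact: measurable_funX.
  by apply: measurable_powR_comp; apply: measurable_funB; exact: measurable_funX.
have F0 p : 0 <= F p.
  rewrite /F; case: ifP => // /andP[r0 _]; case: ifP => // /andP[rs _].
  by rewrite mule_ge0// lee_fin K0// (lt_trans r0).
transitivity (\int[mu]_s \int[vol]_y F (s, y)).
  transitivity (\int[mu]_s (if (0 < s < 1)%R then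
      (mixing_density alpha s)%:E * weighted_int alpha Phi (t * s) else 0)).
    by apply: integral_if => s; rewrite /= in_itv.
  apply: eq_integral => s _; rewrite /F /=.
  have [s0 /=|s0] := ltP 0%R s; last first.
    rewrite integral0_eq// => y _; case: ifP => // /andP[y0 _].
    by case: ifP => // /andP[ys _]; have := lt_le_trans (lt_trans y0 ys) s0; rewrite ltxx.
  case: (boolP (s < 1)%R) => [s1|_]; last first.
    by rewrite integral0_eq// => y _; rewrite andbF; case: ifP.
  (* After z = s y the inner integral runs over |z| < s with weight (1 - |z|^2/s^2)^(-alpha), while
     [Phi (t *: z)] no longer involves s; Tonelli then integrates in s at fixed z. *)
  pose H z := if (0 < enorm z < s)%R then
    ((1 - (enorm z / s) ^+ 2) `^ (- alpha))%:E * Phi (t *: z)%R else 0.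
  have mH : measurable_fun setT H.
    apply: measurable_fun_ifT => //.
      by apply: measurable_and; apply: measurable_fun_ltr => //; exact: measurable_enorm.
    apply: emeasurable_funM => //; apply/measurable_EFinP.
    apply: measurable_powR_comp; apply: measurable_funB => //.
    apply: measurable_funX; apply: measurable_funM => //; exact: measurable_enorm.
  have H0 z : 0 <= H z.
    by rewrite /H; case: ifP => // _; rewrite mule_ge0// lee_fin powR_ge0.
  have -> : weighted_int alpha Phi (t * s) = \int[vol]_y H (s *: y)%R.
    rewrite /weighted_int [LHS]integral_ball; [|exact: k0| |]; last 2 first.
    - apply: emeasurable_funM; last exact: mPt.
      by apply: (measurableT_comp (measurable_weight alpha)); exact: measurable_enorm.
    - by move=> y; rewrite mule_ge0// lee_fin powR_ge0.
    apply: eq_integral => y _; rewrite /H enormZ (gtr0_norm s0).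
    rewrite pmulr_rgt0// gtr_pMr//; case: ifP => // _.
    by rewrite scalerA (mulrC s) mulfK ?gt_eqF.
  rewrite ge0_integral_scale// muleA -EFinM -ge0_integralZl_EFin//; last first.
    by rewrite mulr_ge0 ?mixing_density_ge0// invr_ge0 exprn_ge0// ltW.
  apply: eq_integral => z _; rewrite /H andbT.
  have [z0 /=|_] := ltP 0%R (enorm z); last by rewrite mule0.
  have [zs|_] := ltP (enorm z) s; last by rewrite mule0; case: ifP.
  rewrite (lt_trans zs s1) muleA -EFinM; congr (_ * _); congr EFin.
  have -> : (1 - (enorm z / s) ^+ 2 = (s ^+ 2 - enorm z ^+ 2) * s `^ (- 2%:R))%R.
    by rewrite powR_invn ?(ltW s0)//; field; rewrite gt_eqF.
  have sz : (0 <= s ^+ 2 - enorm z ^+ 2)%R.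
    by rewrite subr_ge0 lerXn2r// ?nnegrE ?ltW.
  rewrite powRM ?powR_ge0// -powRrM /mixing_density /K -powR_invn ?(ltW s0)//.
  set X := ((s ^+ 2 - _) `^ _)%R; set Y := ((1 - s ^+ 2) `^ _)%R.
  (* The Jacobian contributes -k and the denominator of (s^2 - |z|^2) / s^2 contributes 2 alpha. The
     exponent in [mixing_density] is chosen to leave exactly one factor s, the one consumed by u =
     s^2 in [beta_kernel]. *)
  have E1 : (s `^ (k%:R + 1 - 2 * alpha) * s `^ (- k%:R) * s `^ (- 2%:R * - alpha) = s)%R.
    rewrite -!powRD ?(gt_eqF s0) ?implybT//.
    by rewrite -[RHS]powRr1 ?(ltW s0)//; congr (_ `^ _)%R; ring.
  by rewrite -[in RHS]E1; ring.
rewrite (_ : \int[mu]_s \int[vol]_y F (s, y) = \int[vol]_y \int[mu]_s F (s, y)); last first.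
  exact: (@fubini_tonelli _ _ _ _ _ mu vol F mF F0).
have K1 := @beta_int_ge0 R (1 - alpha) alpha.
rewrite /ball_int integral_ball// -ge0_integralZl//; last 3 first.
- apply: measurable_fun_ifT => //.
  by apply: measurable_and; apply: measurable_fun_ltr => //; exact: measurable_enorm.
- by move=> y _; case: ifP.
- by rewrite mule_ge0// lee_fin invr_ge0.
apply: eq_integral => y _; rewrite /F /=.
case: (boolP (0 < enorm y < 1)%R) => [/andP[y0 y1]|_]; last by rewrite mule0 integral0.
rewrite -(@beta_kernel alpha (enorm y))// ?(ltW y0)// -ge0_integralZr//.
- by apply: eq_integral => s _; case: ifP => //; rewrite mul0e.
- apply: measurable_fun_ifT => //.
    by apply: measurable_and; apply: measurable_fun_ltr.
  apply/measurable_EFinP; apply: measurable_funM.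
    apply: measurable_funM => //; apply: measurable_powR_comp.
    by apply: measurable_funB => //; exact: measurable_funX.
  by apply: measurable_powR_comp; apply: measurable_funB => //; exact: measurable_funX.
- by move=> s _; case: ifP => // /andP[ys _]; rewrite lee_fin K0// (lt_trans y0).
Qed.

End mixture.

(** The right side is w^p times the convex combination of w^(-p) and w^(1-p) with weights 1 - p and
    p. Bounding each of these below by exp x >= 1 + x makes the logarithms cancel, so the
    combination is at least 1. *)
Lemma powR_le_affine (R : realType) (w p : R) : 0 < w -> 0 <= p <= 1 ->
  w `^ p <= 1 - p + p * w.
Proof.
move=> w0 /andP[p0 p1].
have pE q : w `^ q = expR (q * ln w) by rewrite /powR gt_eqF.
have wE : w = w `^ p * w `^ (1 - p).
  rewrite -powRD; last by rewrite (gt_eqF w0) implybT.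
  by rewrite addrC subrK powRr1// ltW.
have w1 : 1 = w `^ p * w `^ (- p).
  rewrite -powRD; last by rewrite (gt_eqF w0) implybT.
  by rewrite subrr powRr0.
have e1 : 1 + (1 - p) * ln w <= w `^ (1 - p) by rewrite pE; exact: expR_ge1Dx.
have e2 : 1 + - p * ln w <= w `^ (- p) by rewrite pE; exact: expR_ge1Dx.
have -> : 1 - p + p * w = w `^ p * ((1 - p) * w `^ (- p) + p * w `^ (1 - p)).
  by rewrite mulrDr mulrCA -w1 mulr1 [in RHS]mulrCA -wE.
rewrite -[leLHS]mulr1 ler_wpM2l ?powR_ge0//.
have one : (1 - p) * (1 + - p * ln w) + p * (1 + (1 - p) * ln w) = 1 by ring.
by rewrite -[leLHS]one lerD// ler_wpM2l// subr_ge0.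
Qed.

Section comparison.
Context (R : realType) (k : nat).
Hypothesis k0 : (0 < k)%N.
Local Notation mu := (@lebesgue_measure R).
Local Notation vol := (@vol R k).
Local Open Scope ereal_scope.
Variable Phi : 'rV[R]_k -> \bar R.
Hypotheses (mPhi : measurable_fun setT Phi) (Phi0 : forall y, 0 <= Phi y).

Lemma ball_int_le_weighted (alpha t : R) (C : \bar R) : (0 < alpha < 1)%R ->
  0 <= C -> (0 < t)%R ->
  {ae mu, forall s, (0 < s)%R -> weighted_int alpha Phi s <= C} ->
  ball_int Phi t * ball_weight k alpha <= (ball_volume R k)%:E * C.
Proof.
move=> a01 C0 t0 SC; have /andP[a0 a1] := a01.
have mI : measurable (`]0%R, 1%R[%classic : set R) by exact: measurable_itv.
have q0 (s : R) : 0 <= (mixing_density k alpha s)%:E.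
  by rewrite lee_fin mixing_density_ge0.
have mq : measurable_fun (`]0%R, 1%R[%classic : set R) (EFin \o @mixing_density R k alpha).
  by apply: measurable_funTS; exact: measurable_mixing_density.
have K1 : 1 <= beta_int (1 - alpha) alpha.
  by apply: beta_int_ge1; [rewrite gerBl|]; exact: ltW.
have Koo : beta_int (1 - alpha) alpha < +oo by apply: beta_int_lty; rewrite ?subr_gt0.
have W0 : 0 <= ball_weight k alpha.
  by apply: integral_ge0 => y _; rewrite lee_fin powR_ge0.
have mixC : \int[mu]_(s in `]0%R, 1%R[) ((mixing_density k alpha s)%:E *
      weighted_int alpha Phi (t * s)) <=
    (\int[mu]_(s in `]0%R, 1%R[) (mixing_density k alpha s)%:E) * C.
  rewrite -ge0_integralZr//.
  apply: ae_ge0_le_integral => //.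
  - by move=> s _; rewrite mule_ge0// weighted_int_ge0.
  - apply: measurable_funTS; apply: emeasurable_funM.
      exact: measurable_mixing_density.
    apply: (measurableT_comp (measurable_weighted_int mPhi Phi0 alpha)).
    exact: measurable_funM.
  - by move=> s _; rewrite mule_ge0.
  - by apply: emeasurable_funM.
  have [N [mN N0 PN]] := ae_scale t0 SC.
  exists N; split => // r /= nr; apply: PN => /= SCr; apply: nr.
  rewrite in_itv/= => /andP[r0 _]; apply: lee_wpmul2l; first exact: q0.
  exact: SCr.
(* The mixture identity for the constant function 1 yields the total mass of the mixing density, so
   its closed form is never computed. *)
have mass : (\int[mu]_(s in `]0%R, 1%R[) (mixing_density k alpha s)%:E) *
    ball_weight k alpha =
    (2^-1)%:E * beta_int (1 - alpha) alpha * (ball_volume R k)%:E.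
  have := @mixing_weighted_int R k k0 (cst 1) (measurable_cst _) (fun=> lee01) alpha t a01.
  rewrite /ball_int integral_ball_cst mul1e => <-.
  rewrite -ge0_integralZr//; apply: eq_integral => s _; congr (_ * _).
  by apply: eq_integral => y _; rewrite mule1.
have := lee_wpmul2r W0 mixC.
rewrite mixing_weighted_int// [X in _ <= X]muleAC mass -!muleA.
move: K1 Koo; case: (beta_int _ _) => [K| |]// K1 _.
rewrite lee_fin in K1.
by rewrite !muleA -EFinM -!muleA lee_pmul2l// lte_fin; lra.
Qed.

Lemma weighted_int_interp (alpha theta t : R) : (0 <= theta <= 1)%R ->
  weighted_int (theta * alpha) Phi t <=
  (1 - theta)%:E * ball_int Phi t + theta%:E * weighted_int alpha Phi t.
Proof.
move=> th01; have /andP[th0 th1] := th01.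
have mB := @measurable_unit_ball R k.
have mPt : measurable_fun setT (fun y : 'rV[R]_k => Phi (t *: y)%R).
  by apply: (measurableT_comp mPhi); exact: measurable_scale_rV.
have mw a : measurable_fun setT
    (fun y : 'rV[R]_k => ((1 - enorm y ^+ 2) `^ (- a))%:E).
  by apply: (measurableT_comp (measurable_weight a)); exact: measurable_enorm.
have w0 a (y : 'rV[R]_k) :
    0 <= ((1 - enorm y ^+ 2) `^ (- a))%:E * Phi (t *: y)%R.
  by rewrite mule_ge0// lee_fin powR_ge0.
have mwP a : measurable_fun setT
    (fun y : 'rV[R]_k => ((1 - enorm y ^+ 2) `^ (- a))%:E * Phi (t *: y)%R).
  exact: emeasurable_funM.
have th0' : 0 <= (1 - theta)%:E by rewrite lee_fin subr_ge0.
rewrite /weighted_int /ball_int.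
rewrite -ge0_integralZl//; last exact: measurable_funTS.
rewrite -ge0_integralZl//; last exact: measurable_funTS.
rewrite -ge0_integralD//; last 4 first.
- by move=> y _; rewrite mule_ge0.
- by apply: measurable_funTS; exact: measurable_funeM.
- by move=> y _; rewrite mule_ge0.
- by apply: measurable_funTS; exact: measurable_funeM.
apply: ge0_le_integral => //.
- exact: measurable_funTS.
- by apply: measurable_funTS; apply: emeasurable_funD; exact: measurable_funeM.
move=> y /= yB; rewrite muleA -EFinM -ge0_muleDl//; last first.
  by rewrite lee_fin mulr_ge0// powR_ge0.
rewrite -EFinD lee_wpmul2r// lee_fin.
have y0 : (0 < 1 - enorm y ^+ 2)%R by rewrite subr_gt0 expr_lt1// enorm_ge0.
rewrite (_ : - (theta * alpha) = - alpha * theta)%R; last by ring.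
by rewrite powRrM powR_le_affine// powR_gt0.
Qed.

End comparison.

(** * The limit at 1 *)

Section interval_averages.
Context {R : realType}.
Local Notation mu := (@lebesgue_measure R).
Local Open Scope ereal_scope.

Lemma ge0_integral_le_cover (f : R -> \bar R) (F : (set R)^nat) (E : set R) :
  measurable_fun setT f -> (forall s, 0 <= f s) ->
  (forall i, measurable (F i)) -> measurable E -> E `<=` \bigcup_i F i ->
  \int[mu]_(s in E) f s <= \sum_(i <oo) \int[mu]_(s in F i) f s.
Proof.
move=> mf f0 mF mE EF.
apply: (@le_trans _ _ (\int[mu]_(s in \bigcup_i F i) f s)).
  apply: ge0_subset_integral => //; last exact: measurable_funTS.
  by apply: bigcup_measurable => i _; exact: mF.
have mD i : measurable (seqDU F i).
  apply: measurableD; first exact: mF.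
  by apply: bigsetU_measurable => j _; exact: mF.
rewrite seqDU_bigcup_eq ge0_integral_bigcup//; last exact: measurable_funTS.
apply: lee_nneseries => [i _ _|i _]; first exact: integral_ge0.
by apply: ge0_subset_integral;
  [exact: mD|exact: mF|exact: measurable_funTS|move=> *; exact: f0|exact: subDsetl].
Qed.

(** Lebesgue measure unfolds to an infimum of total lengths over covers by half-open intervals. For
    each cover the integral over [E] is at most the sum over its members, where the interval bound
    applies; [0 < L] lets [L] pass inside the infimum. *)
Lemma integral_le_of_itv (f : R -> \bar R) (L : R) (E : set R) :
  measurable_fun setT f -> (forall s, 0 <= f s) -> (0 < L)%R ->
  (forall a b, (a < b)%R ->
    \int[mu]_(s in `]a, b]) f s <= (L * (b - a))%:E) ->
  measurable E -> \int[mu]_(s in E) f s <= L%:E * mu E.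
Proof.
move=> mf f0 L0 fL mE.
rewrite /lebesgue_measure /lebesgue_stieltjes_measure /measure_extension.
rewrite /mu_ext -ereal_inf_pZl//.
apply: le_ereal_inf_tmp => _ [_ [F [mF EF] <-] <-].
have mF' i : measurable (F i : set R) by exact: sub_sigma_algebra.
apply: (le_trans (ge0_integral_le_cover mf f0 mF' mE EF)).
rewrite -nneseriesZl//.
apply: lee_nneseries => [i _ _|i _]; first exact: integral_ge0.
have [[a b] _ <- /=] := mF i.
have [ab|ba] := ltP a b.
  by rewrite wlength_itv_bnd ?(ltW ab)// -EFinM; exact: fL.
rewrite set_itv_ge ?bnd_simp -?leNgt//.
by rewrite integral_set0 wlength0 mule0.
Qed.

(** On a set E of finite measure where f >= L + e, the interval bound extended to E gives (L + e)
    mu(E) <= L mu(E), so E is null. This takes the place of Lebesgue differentiation and assumes no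
    integrability of [f]. *)
Lemma ae_le_of_itv (f : R -> \bar R) (L : R) :
  measurable_fun setT f -> (forall s, 0 <= f s) -> (0 < L)%R ->
  (forall a b, (0 <= a)%R -> (a < b)%R ->
    \int[mu]_(s in `]a, b]) f s <= (L * (b - a))%:E) ->
  {ae mu, forall s, (0 < s)%R -> f s <= L%:E}.
Proof.
move=> mf f0 L0 fL.
pose g (s : R) := if (0 < s)%R then f s else 0.
have mg : measurable_fun setT g.
  by apply: measurable_fun_ifT => //; exact: measurable_fun_ltr.
have g0 s : 0 <= g s by rewrite /g; case: ifP.
have gL (a b : R) : (a < b)%R ->
    \int[mu]_(s in `]a, b]) g s <= (L * (b - a))%:E.
  (* The bound is assumed only for a >= 0; [g] vanishes on the negative half-line, so the left end
     can be moved up to 0. *)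
  move=> ab; pose c := Num.max a 0%R.
  have -> : \int[mu]_(s in `]a, b]) g s = \int[mu]_(s in `]c, b]) f s.
    transitivity (\int[mu]_s (if (a < s <= b)%R then g s else 0)).
      by apply: integral_if => s; rewrite /= in_itv.
    transitivity (\int[mu]_s (if (c < s <= b)%R then f s else 0)); last first.
      by apply/esym/integral_if => s; rewrite /= in_itv.
    apply: eq_integral => s _; rewrite /g /c gt_max.
    by case: (a < s)%R; case: (0 < s)%R => //=; case: ifP.
  have [cb|bc] := ltP c b.
    apply: le_trans (fL c b _ cb) _; first by rewrite /c le_max lexx orbT.
    by rewrite lee_fin ler_pM2l// lerD2l lerN2 /c le_max lexx.
  rewrite set_itv_ge ?bnd_simp -?leNgt//.
  by rewrite integral_set0 lee_fin mulr_ge0 ?subr_ge0 ?ltW.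
(* Cutting at n makes the measure finite, so that L mu(E n) can be subtracted. *)
pose E n := `]0%R, n%:R]%classic `&` [set s : R | (L + n.+1%:R^-1)%:E <= f s].
have mE n : measurable (E n).
  apply: measurableI; first exact: measurable_itv.
  by rewrite -[X in measurable X]setTI; exact: emeasurable_fun_c_infty.
have E0 n : mu (E n) = 0.
  have Efin : mu (E n) < +oo.
    apply: (@le_lt_trans _ _ (mu `]0%R, n%:R]%classic)).
      apply: le_measure; rewrite ?inE; [exact: mE|exact: measurable_itv|exact: subIsetl].
    by rewrite lebesgue_measure_itv/=; case: ifP; rewrite ?ltry.
  have h1 := integral_le_of_itv mg g0 L0 gL (mE n).
  have h2 : (L + n.+1%:R^-1)%:E * mu (E n) <= \int[mu]_(s in E n) g s.
    apply: (@le_trans _ _ (\int[mu]_(s in E n) (L + n.+1%:R^-1)%:E)).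
      by rewrite integral_cst//; exact: mE.
    apply: ge0_le_integral; first exact: mE.
    - by move=> s _; rewrite lee_fin addr_ge0// ltW.
    - exact: measurable_cst.
    - exact: measurable_funTS.
    by move=> s [/= + fs]; rewrite in_itv/= /g => /andP[-> _].
  have E0 : 0 <= mu (E n) by exact: measure_ge0.
  move: (le_trans h2 h1) E0.
  move: Efin; case: (mu (E n)) => [x| |]// _.
  rewrite -!EFinM !lee_fin => h x0; congr EFin; apply/eqP.
  rewrite eq_le x0 andbT.
  have n0 : (0 < n.+1%:R^-1 :> R)%R by rewrite invr_gt0.
  rewrite -(pmulr_rle0 _ n0); by move: h; rewrite mulrDl gerDl.
have : mu.-negligible (\bigcup_n E n).
  apply: negligible_bigcup => n; apply/negligibleP; [exact: mE|exact: E0].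
apply: negligibleS => s /= /not_implyP[s0 /negP]; rewrite -ltNge => Lf.
have [e e0 Le] : exists2 e, (0 < e)%R & (L + e)%:E <= f s.
  move: Lf; case: (f s) => [x| |]//; rewrite ?lte_fin => Lx.
    exists (x - L)%R; first by rewrite subr_gt0.
    by rewrite addrC subrK.
  by exists 1%R => //; rewrite leey.
(* The first entry gives s <= n, the second 1/(n+1) <= e. *)
exists (maxn (Num.truncn s).+1 (Num.truncn e^-1)) => //; split => /=.
  rewrite in_itv/= s0/=; apply: (@le_trans _ _ (Num.truncn s).+1%:R).
    exact/ltW/truncnS_gt.
  by rewrite ler_nat leq_maxl.
apply: le_trans Le; rewrite lee_fin lerD2l.
rewrite -[leRHS]invrK lef_pV2 ?posrE ?invr_gt0//.
apply: (le_trans (ltW (truncnS_gt e^-1))).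
by rewrite ler_nat ltnS leq_maxr.
Qed.

End interval_averages.

(** * Concentration of the weights at radius one *)

Section concentration.
Context (R : realType) (k : nat).
Hypothesis k0 : (0 < k)%N.
Local Notation mu := (@lebesgue_measure R).
Local Notation vol := (@vol R k).
Local Notation bv := (ball_volume R k).
Local Open Scope ereal_scope.
Variable Phi : 'rV[R]_k -> \bar R.
Hypotheses (mPhi : measurable_fun setT Phi) (Phi0 : forall y, 0 <= Phi y).

Let mS : measurable_fun setT (sphere_int Phi).
Proof. exact: measurable_sphere_int. Qed.

Let S0 s : 0 <= sphere_int Phi s.
Proof. exact: sphere_int_ge0. Qed.

(** As t runs over ]a, b'], t r runs over ]r a, r b'], which contains ]a, b] because r <= 1 and b <=
    r b'; the Jacobian 1/r is at least 1. *)
Lemma sphere_int_dilate (a b b' r : R) : (0 <= a)%R -> (0 < b')%R ->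
  (b / b' <= r)%R -> (0 < r <= 1)%R ->
  \int[mu]_(s in `]a, b]) sphere_int Phi s <=
  \int[mu]_(t in `]a, b']) sphere_int Phi (t * r).
Proof.
move=> a0 b'0 br /andP[r0 r1].
pose G (s : R) := if (r * a < s <= r * b')%R then sphere_int Phi s else 0.
have mG : measurable_fun setT G.
  apply: measurable_fun_ifT => //; apply: measurable_and.
    exact: measurable_fun_ltr.
  exact: measurable_fun_ler.
have G0 s : 0 <= G s by rewrite /G; case: ifP.
have -> : \int[mu]_(t in `]a, b']) sphere_int Phi (t * r) = \int[mu]_t G (r * t)%R.
  transitivity (\int[mu]_t (if (a < t <= b')%R then sphere_int Phi (t * r) else 0)).
    by apply: integral_if => t; rewrite /= in_itv.
  by apply: eq_integral => t _; rewrite /G ltr_pM2l// ler_pM2l// mulrC.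
rewrite ge0_integral_scale1//.
have -> : \int[mu]_(s in `]a, b]) sphere_int Phi s =
    \int[mu]_s (if (a < s <= b)%R then sphere_int Phi s else 0).
  by apply: integral_if => t; rewrite /= in_itv.
apply: (@le_trans _ _ (\int[mu]_s G s)).
  apply: ge0_le_integral => //.
  - by move=> s _; case: ifP.
  - apply: measurable_fun_ifT => //; apply: measurable_and.
      exact: measurable_fun_ltr.
    exact: measurable_fun_ler.
  move=> s _; case: ifP => // /andP[sa sb].
  rewrite /G (_ : (r * a < s <= r * b')%R = true)//; apply/andP; split.
    by rewrite (le_lt_trans _ sa)// ler_piMl.
  by rewrite (le_trans sb)// -ler_pdivrMr.
rewrite -[leLHS]mul1e; apply: lee_wpmul2r; first exact: integral_ge0.
by rewrite lee_fin invf_ge1.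
Qed.

(** Tonelli in the scale t and the radius r. Radii below b/b' are dropped; for each remaining r the
    enlarged interval ]a, b'] still sees all of ]a, b] after dilation. *)
Lemma weighted_int_itv_ge (alpha a b b' : R) : (0 <= a)%R -> (0 < b)%R -> (b < b')%R ->
  k%:R%:E * \int[mu]_(r in `](b / b')%R, 1%R[) (polar_density k alpha r)%:E *
    \int[mu]_(s in `]a, b]) sphere_int Phi s <=
  \int[mu]_(t in `]a, b']) weighted_int alpha Phi t.
Proof.
move=> a0 b0 bb'; have b'0 := lt_trans b0 bb'.
have mp := @measurable_polar_density R k alpha.
have p0 r : 0 <= (polar_density k alpha r)%:E by rewrite lee_fin polar_density_ge0.
pose F (p : R * R) := if (a < p.1 <= b')%R then
  if (0 < p.2 < 1)%R then (polar_density k alpha p.2)%:E * sphere_int Phi (p.1 * p.2)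
  else 0 else 0.
have mF : measurable_fun setT F.
  apply: measurable_fun_ifT => //.
    apply: measurable_and; first exact: measurable_fun_ltr.
    exact: measurable_fun_ler.
  apply: measurable_fun_ifT => //.
    by apply: measurable_and; apply: measurable_fun_ltr.
  apply: emeasurable_funM; first exact: (measurableT_comp mp).
  by apply: (measurableT_comp mS); exact: measurable_funM.
have F0 p : 0 <= F p.
  by rewrite /F; case: ifP => // _; case: ifP => // _; rewrite mule_ge0.
have mPS (t : R) : measurable_fun setT
    (fun r : R => (polar_density k alpha r)%:E * sphere_int Phi (t * r)).
  apply: emeasurable_funM; first exact: mp.
  by apply: (measurableT_comp mS); exact: measurable_funM.
have mPr (r : R) : measurable_fun setT (fun t : R => sphere_int Phi (t * r)).
  by apply: (measurableT_comp mS); exact: measurable_funM.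
have -> : \int[mu]_(t in `]a, b']) weighted_int alpha Phi t =
    k%:R%:E * \int[mu]_t \int[mu]_r F (t, r).
  transitivity (\int[mu]_t (if (a < t <= b')%R then weighted_int alpha Phi t else 0)).
    by apply: integral_if => t; rewrite /= in_itv.
  rewrite -ge0_integralZl//; last 2 first.
  - exact: (@measurable_fun_fubini_tonelli_F _ _ _ _ _ mu F mF F0).
  - by move=> t _; exact: integral_ge0.
  apply: eq_integral => t _; rewrite /F /=.
  case: (a < t <= b')%R; last by rewrite integral0 mule0.
  rewrite weighted_int_polar//; congr (_ * _).
  by apply: integral_if => r; rewrite /= in_itv.
rewrite -muleA; apply: lee_wpmul2l => //.
rewrite (_ : \int[mu]_t \int[mu]_r F (t, r) = \int[mu]_r \int[mu]_t F (t, r)); last first.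
  exact: (@fubini_tonelli _ _ _ _ _ mu mu F mF F0).
have I0 : 0 <= \int[mu]_(s in `]a, b]) sphere_int Phi s by exact: integral_ge0.
rewrite -ge0_integralZr//; last exact: measurable_funTS.
rewrite [leLHS](_ : _ = \int[mu]_r (if (b / b' < r < 1)%R then
    (polar_density k alpha r)%:E * \int[mu]_(s in `]a, b]) sphere_int Phi s else 0)); last first.
  by apply: integral_if => r; rewrite /= in_itv.
apply: ge0_le_integral => //.
- by move=> r _; case: ifP => // _; rewrite mule_ge0.
- apply: measurable_fun_ifT => //.
    by apply: measurable_and; apply: measurable_fun_ltr.
  exact: emeasurable_funM.
- exact: (@measurable_fun_fubini_tonelli_G _ _ _ _ _ mu F mF F0).
move=> r _; case: ifP => [/andP[br r1]|_]; last exact: integral_ge0.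
have r0 : (0 < r)%R by rewrite (lt_trans _ br)// divr_gt0.
have -> : \int[mu]_t F (t, r) =
    (polar_density k alpha r)%:E * \int[mu]_(t in `]a, b']) sphere_int Phi (t * r).
  rewrite -ge0_integralZl//; last exact: (measurable_funTS (mPr r)).
  rewrite [RHS](_ : _ = \int[mu]_t (if (a < t <= b')%R then
    (polar_density k alpha r)%:E * sphere_int Phi (t * r) else 0)); last first.
    by apply: integral_if => t; rewrite /= in_itv.
  by apply: eq_integral => t _; rewrite /F /= r0 r1.
apply: lee_wpmul2l => //; apply: sphere_int_dilate => //; first exact: ltW.
by rewrite r0 ltW.
Qed.

(** For r <= eta, (1-r^2)^alpha >= 1-r^2 >= 1-eta^2, so the inner part of the mass has a bound free
    of alpha. The factor k disappears there because k times the integral of r^(k-1) over ]0, 1[ is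
    1. *)
Lemma ball_weight_le_tail (alpha eta : R) : (0 < alpha < 1)%R -> (0 < eta < 1)%R ->
  ball_weight k alpha <= bv%:E * ((1 - eta ^+ 2)^-1%:E +
    k%:R%:E * \int[mu]_(r in `]eta, 1%R[) (polar_density k alpha r)%:E).
Proof.
move=> /andP[a0 a1] /andP[e0 e1].
have bv0 := ball_volume_gt0 R k.
have kR : (0 < k%:R :> R)%R by rewrite ltr0n.
have mp := @measurable_polar_density R k alpha.
have p0 r : 0 <= (polar_density k alpha r)%:E by rewrite lee_fin polar_density_ge0.
have e2 : (0 < 1 - eta ^+ 2)%R by rewrite subr_gt0 expr_lt1// ltW.
rewrite ball_weight_polar// [(k%:R * bv)%R]mulrC EFinM -muleA.
apply: lee_wpmul2l; first by rewrite lee_fin ltW.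
pose g (r : R) := ((1 - eta ^+ 2)^-1 * r `^ (k%:R - 1))%:E.
pose h (r : R) := if (eta < r < 1)%R then (polar_density k alpha r)%:E else 0.
have g0 r : 0 <= g r by rewrite lee_fin mulr_ge0 ?powR_ge0// invr_ge0 ltW.
have mg : measurable_fun setT g.
  by apply/measurable_EFinP; apply: measurable_funM => //; exact: measurable_powR_comp.
have h0 r : 0 <= h r by rewrite /h; case: ifP.
have mh : measurable_fun setT h.
  apply: measurable_fun_ifT => //.
  by apply: measurable_and; apply: measurable_fun_ltr.
have mI : measurable (`]0%R, 1%R[%classic : set R) by exact: measurable_itv.
have gE : k%:R%:E * \int[mu]_(r in `]0%R, 1%R[) g r = (1 - eta ^+ 2)^-1%:E.
  have -> : \int[mu]_(r in `]0%R, 1%R[) g r = ((1 - eta ^+ 2)^-1 / k%:R)%:E.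
    rewrite EFinM -(integral_powR01 kR) -ge0_integralZl//.
    - by apply/measurable_EFinP; apply: measurable_funTS; exact: measurable_powR_comp.
    - by move=> r _; rewrite lee_fin powR_ge0.
    - by rewrite lee_fin invr_ge0 ltW.
  by rewrite -EFinM mulrCA mulfV ?mulr1// gt_eqF.
have hE : \int[mu]_(r in `]eta, 1%R[) (polar_density k alpha r)%:E =
    \int[mu]_(r in `]0%R, 1%R[) h r.
  transitivity (\int[mu]_r h r).
    by apply: integral_if => r; rewrite /= in_itv.
  transitivity (\int[mu]_r (if (0 < r < 1)%R then h r else 0)); last first.
    by apply/esym/integral_if => r; rewrite /= in_itv.
  apply: eq_integral => r _; case: ifP => //; rewrite /h.
  case: ifP => // /andP[er r1]; rewrite r1 andbT => /negP[].
  exact: lt_trans er.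
rewrite -gE hE -muleDr//; last first.
  by rewrite ge0_adde_def// inE integral_ge0.
apply: lee_wpmul2l => //.
rewrite -ge0_integralD//; last 2 first.
- exact: measurable_funTS.
- exact: measurable_funTS.
apply: ge0_le_integral => //.
- exact: measurable_funTS.
- by apply: measurable_funTS; exact: emeasurable_funD.
move=> r; rewrite /= in_itv/= => /andP[r0 r1].
have [er|re] := ltP eta r.
  by rewrite /h er r1/= leeDr.
rewrite /h [(eta < r)%R]ltNge re/= adde0 lee_fin /polar_density mulrC.
rewrite ler_wpM2r ?powR_ge0// powRN lef_pV2 ?posrE ?powR_gt0//; last first.
  by rewrite subr_gt0 expr_lt1// ltW.
have re2 : (1 - eta ^+ 2 <= 1 - r ^+ 2)%R.
  by rewrite lerD2l lerN2 lerXn2r// ?nnegrE ltW.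
apply: (le_trans re2).
rewrite -[leLHS]powRr1 ?(le_trans (ltW e2))//.
apply: ger_powR; last exact: ltW.
by rewrite (lt_le_trans e2 re2)/= gerBl sqr_ge0.
Qed.

End concentration.

Section concentration_limit.
Context (R : realType) (k : nat).
Hypothesis k1 : (1 < k)%N.
Local Notation mu := (@lebesgue_measure R).
Local Notation vol := (@vol R k).
Local Notation bv := (ball_volume R k).
Local Open Scope ereal_scope.
Variable Phi : 'rV[R]_k -> \bar R.
Hypotheses (mPhi : measurable_fun setT Phi) (Phi0 : forall y, 0 <= Phi y).

Lemma exists_real_between (x : R) (y : \bar R) : x%:E < y ->
  exists2 z : R, (x < z)%R & z%:E <= y.
Proof.
case: y => [y| |]//; first by rewrite lte_fin => xy; exists y.
by move=> _; exists (x + 1)%R; rewrite ?leey// ltrDl.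
Qed.

(** [L] is a level for the normalized means: [bv] and W(alpha) are their respective masses. One
    interval on which A is too large determines [d], hence all alpha close to 1 at once. *)
Lemma not_ae_weighted_int_le (L : R) : (0 < L)%R ->
  ~ {ae mu, forall s, (0 < s)%R -> sphere_int Phi s <= (bv * L)%:E} ->
  exists2 d : R, (0 < d)%R & forall alpha, (0 < alpha < 1)%R -> (1 - d < alpha)%R ->
    ~ {ae mu, forall t, (0 < t)%R ->
        weighted_int alpha Phi t <= ball_weight k alpha * L%:E}.
Proof.
move=> L0 nS; have k0 : (0 < k)%N by exact: ltnW.
have bv0 := ball_volume_gt0 R k.
pose l := (bv * L)%R; have l0 : (0 < l)%R by rewrite mulr_gt0.
have mS := measurable_sphere_int mPhi Phi0.
have S0 := sphere_int_ge0 Phi0.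
have [[a [b [a0 ab lI]]]|nI] := pselect (exists a b, [/\ (0 <= a)%R, (a < b)%R &
    (l * (b - a))%:E < \int[mu]_(s in `]a, b]) sphere_int Phi s]); last first.
  exfalso; apply: nS; apply: ae_le_of_itv => // a b a0 ab.
  by rewrite leNgt; apply/negP => lI; apply: nI; exists a, b.
have b0 : (0 < b)%R by rewrite (le_lt_trans a0).
(* The integral over ]a, b] may be infinite; a finite lower bound that still exceeds l (b - a) is
   enough. *)
have [I' lI' I'I] := exists_real_between lI.
(* Chosen so that l (b' - a) is the midpoint of l (b - a) and I': enlarging the interval spends half
   of the excess and leaves the other half as [gap]. *)
pose b' := (b + (I' - l * (b - a)) / (2 * l))%R.
have bb' : (b < b')%R by rewrite ltrDl divr_gt0 ?subr_gt0// mulr_gt0.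
have b'0 := lt_trans b0 bb'.
pose gap := (I' - l * (b' - a))%R.
have gapE : gap = ((I' - l * (b - a)) / 2)%R.
  by rewrite /gap /b'; field; rewrite gt_eqF.
have gap0 : (0 < gap)%R by rewrite gapE divr_gt0// subr_gt0.
have I'0 : (0 < I')%R.
  by rewrite (le_lt_trans _ lI')// mulr_ge0 ?subr_ge0 ?(ltW l0) ?(ltW ab).
pose eta := (b / b')%R.
have eta01 : (0 < eta < 1)%R by rewrite divr_gt0//= ltr_pdivrMr// mul1r.
pose D := ((1 - eta ^+ 2)^-1)%R.
have D0 : (0 < D)%R.
  by move/andP: eta01 => [e0 e1]; rewrite invr_gt0 subr_gt0 expr_lt1// ltW.
(* The assumed bound will give w gap <= v_k D I' <= w (1 - alpha) D I', which fails as soon as (1 -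
   alpha) D I' < gap. *)
exists (gap / (D * I'))%R; first by rewrite divr_gt0// mulr_gt0.
move=> alpha a01 da wL; have /andP[al0 al1] := a01.
have tail := ball_weight_le_tail k0 a01 eta01.
have mass := weighted_int_itv_ge k0 mPhi Phi0 alpha a0 b0 bb'.
have lower := ball_weight_ge k0 k1 a01.
move: tail mass lower wL; rewrite ball_weight_beta//; set w := (_ * euler_beta _ _)%R.
set T := _ * \int[mu]_(r in _) (polar_density _ _ _)%:E => tail mass lower wL.
have w0 : (0 <= w)%R.
  by rewrite -lee_fin (le_trans _ lower)// lee_fin divr_ge0 ?subr_ge0 ?ltW.
have T0 : 0 <= T.
  by rewrite mule_ge0// integral_ge0// => r _; rewrite lee_fin polar_density_ge0.
have upper : T * I'%:E <= (w * L * (b' - a))%:E.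
  apply: (@le_trans _ _ (\int[mu]_(t in `]a, b']) weighted_int alpha Phi t)).
    by apply: le_trans mass; apply: lee_wpmul2l.
  have -> : (w * L * (b' - a))%:E = \int[mu]_(t in `]a, b']) (w * L)%:E.
    have I1 : mu (`]a, b']%classic : set R) = (b' - a)%:E.
      by rewrite lebesgue_measure_itv/= lte_fin (lt_trans ab bb').
    by rewrite EFinM -I1 integral_cst//; exact: measurable_itv.
  have mI : measurable (`]a, b']%classic : set R) by exact: measurable_itv.
  apply: ae_ge0_le_integral => //.
  - by move=> t _; exact: weighted_int_ge0.
  - by apply: measurable_funTS; exact: measurable_weighted_int.
  - by move=> t _; rewrite lee_fin mulr_ge0// ltW.
  have [N [mN N0 PN]] := wL.
  exists N; split => // t /= nt; apply: PN => /= wt; apply: nt.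
  rewrite in_itv/= => /andP[at_ _]; rewrite EFinM.
  by apply: wt; exact: le_lt_trans a0 at_.
have {}lower : (bv <= w * (1 - alpha))%R.
  by rewrite -ler_pdivrMr ?subr_gt0// -lee_fin.
move: T0 tail upper; case: (T) => [tau| |]// _; last first.
  by rewrite gt0_mulye ?lte_fin.
rewrite -EFinD -!EFinM !lee_fin => tail upper.
(* [w] grows like [1 / (1 - alpha)] while its part [bv * D] of radius below [eta]
   stays bounded. *)
have h1 : (w * I' <= bv * D * I' + bv * (tau * I'))%R.
  have := ler_wpM2r (ltW I'0) tail; rewrite -/D; lra.
have h2 : (bv * (tau * I') <= w * (l * (b' - a)))%R.
  have := ler_wpM2l (ltW bv0) upper; rewrite /l; lra.
have h3 : (w * gap <= bv * (D * I'))%R by rewrite /gap mulrBr; lra.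
have DI : (0 < D * I')%R by rewrite mulr_gt0.
have h4 : ((1 - alpha) * (D * I') < gap)%R.
  by rewrite -ltr_pdivlMr//; lra.
have h5 : (bv * (D * I') <= w * ((1 - alpha) * (D * I')))%R.
  by rewrite [leRHS]mulrA ler_wpM2r// ltW.
have wp : (0 < w)%R.
  rewrite lt_neqAle w0 andbT eq_sym; apply/eqP => w00.
  by move: lower; rewrite w00 mul0r leNgt bv0.
have := le_trans h3 h5.
by rewrite ler_pM2l// leNgt h4.
Qed.

End concentration_limit.

(** * Non-Borel representatives *)

Section integral_off_null.
Import HBNNSimple.

(* No measurability of [f] or [g]: a simple function below [f] is below [g] once
   it is set to 0 on [N]. *)
Lemma nnintegral_null_le d (T : measurableType d) (R : realType)
    (mu : {measure set T -> \bar R}) (N : set T) (f g : T -> \bar R) :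
  measurable N -> mu N = 0%E -> (forall x, 0 <= f x)%E -> (forall x, 0 <= g x)%E ->
  (forall x, ~ N x -> f x = g x) ->
  (\int[mu]_x f x <= \int[mu]_x g x)%E.
Proof.
move=> mN N0 f0 g0 fg; rewrite !ge0_integralTE//.
apply: ge_ereal_sup => _ [phi phif <-].
pose psi := proj_nnsfun phi (measurableC mN).
have -> : sintegral mu phi = sintegral mu psi.
  have := @integral_nnsfun _ _ _ mu setT measurableT phi.
  have := @integral_nnsfun _ _ _ mu setT measurableT psi.
  rewrite !patch_setT => <- <-.
  apply: ge0_ae_eq_integral => //.
  - by apply/measurable_EFinP.
  - by apply/measurable_EFinP.
  - by move=> x _; rewrite lee_fin.
  - by move=> x _; rewrite lee_fin.
  exists N; split => // x /= nx; apply: contrapT => xN; apply: nx => _.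
  by rewrite /psi /= mindicE mem_set// mulr1.
apply: ereal_sup_ubound; exists psi => //= x.
rewrite /= mindicE; have [xN|xN] := pselect (N x).
  by rewrite memNset; [rewrite mulr0|move=> /(_ xN)].
by rewrite mem_set// mulr1 -fg.
Qed.

End integral_off_null.

Lemma integral_eq_off_null d (T : measurableType d) (R : realType)
    (mu : {measure set T -> \bar R}) (D N : set T) (f g : T -> \bar R) :
  measurable N -> mu N = 0%E -> (forall x, 0 <= f x)%E -> (forall x, 0 <= g x)%E ->
  (forall x, D x -> ~ N x -> f x = g x) ->
  (\int[mu]_(x in D) f x = \int[mu]_(x in D) g x)%E.
Proof.
move=> mN N0 f0 g0 fg; rewrite integral_mkcond [RHS]integral_mkcond.
have r0 (h : T -> \bar R) : (forall x, 0 <= h x)%E -> forall x, (0 <= (h \_ D) x)%E.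
  by move=> h0 x; rewrite patchE; case: ifP.
have r1 x : ~ N x -> (f \_ D) x = (g \_ D) x.
  by move=> Nx; rewrite !patchE; case: ifPn => // /set_mem Dx; exact: fg.
apply/eqP; rewrite eq_le; apply/andP; split; apply: (nnintegral_null_le mN N0);
  try exact: r0; first exact: r1.
by move=> x Nx; rewrite r1.
Qed.

Lemma ge0_integral_mrestr d (T : measurableType d) (R : realType)
    (mu : {measure set T -> \bar R}) (D E : set T) (mD : measurable D)
    (f : T -> \bar R) : measurable E -> measurable_fun setT f ->
  (forall x, 0 <= f x)%E ->
  (\int[mrestr mu mD]_(x in E) f x = \int[mu]_(x in E `&` D) f x)%E.
Proof.
move=> mE mf f0.
have D0 : mrestr mu mD (~` D) = 0%E by rewrite /mrestr setICl measure0.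
rewrite (ge0_negligible_integral (measurableC mD) mE (measurable_funTS mf) _ D0)//.
rewrite setDE setCK; apply: eq_measure_integral => A mA AED.
by rewrite /= /mrestr setIidl// => x /AED[].
Qed.

(** * Surface measure and null sets *)

Section sphere.
Context (R : realType) (k : nat).
Local Notation mu := (@lebesgue_measure R).
Local Notation vol := (@vol R k).
Local Notation bv := (ball_volume R k).
Local Open Scope ereal_scope.

Lemma measurable_unit_sphere : measurable (@unit_sphere R k).
Proof.
have -> : @unit_sphere R k = setT `&` @enorm R k @^-1` [set 1%R].
  by rewrite setTI.
exact: measurable_enorm.
Qed.

(** Radial projection pulls the sphere back to the ball without its centre, which is the ball up to
    a null set. *)
Lemma integral_sphere (Phi : 'rV[R]_k -> \bar R) (t : R) : (0 < k)%N ->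
  measurable_fun setT Phi -> (forall y, 0 <= Phi y) ->
  \int[sphere_measure R k]_(y in unit_sphere) Phi (t *: y)%R =
  k%:R%:E * sphere_int Phi t.
Proof.
move=> k0 mPhi Phi0.
have mPt : measurable_fun setT (fun y : 'rV[R]_k => Phi (t *: y)%R).
  by apply: (measurableT_comp mPhi); exact: measurable_scale_rV.
have mS := measurable_unit_sphere.
rewrite ge0_integral_mscale//; last exact: measurable_funTS.
congr (_ * _).
rewrite ge0_integral_pushforward//; last 2 first.
- exact: measurable_radial_proj.
- exact: measurable_funTS.
have mPr : measurable_fun setT (fun y : 'rV[R]_k => Phi (t *: radial_proj y)%R).
  apply: (measurableT_comp mPhi); apply: measurable_scale_rV => //.
  exact: measurable_radial_proj.
have mE : measurable (@radial_proj R k @^-1` unit_sphere).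
  by rewrite -[X in measurable X]setTI; exact: measurable_radial_proj.
rewrite (ge0_integral_mrestr _ _ mE mPr)//.
rewrite /sphere_int integral_ball//.
apply: integral_if => y; rewrite /unit_sphere /unit_ball /= /radial_proj enormZ.
split => [[y1 yB]|/andP[y0 y1]].
  rewrite yB andbT lt_neqAle enorm_ge0 andbT eq_sym; apply/eqP => y0.
  by move: y1; rewrite y0 mulr0 => /esym/eqP; rewrite oner_eq0.
by split => //; rewrite ger0_norm ?invr_ge0 ?enorm_ge0// mulVf// gt_eqF.
Qed.

Lemma sphere_areaE : (0 < k)%N -> sphere_area R k = (k%:R * bv)%R.
Proof.
move=> k0; rewrite /sphere_area.
have := @integral_sphere (cst 1) 1 k0 (measurable_cst _) (fun=> lee01).
rewrite integral_cst; last exact: measurable_unit_sphere.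
by rewrite mul1e /sphere_int integral_ball_cst mul1e => ->.
Qed.

(* The concentration argument applied to the indicator of [N], all of whose
   weighted ball averages vanish. *)
Lemma ae_sphere_null (N : set 'rV[R]_k) : (1 < k)%N ->
  measurable N -> vol N = 0 ->
  {ae mu, forall t, (0 < t)%R ->
    sphere_measure R k (unit_sphere `&` (fun y => t *: y)%R @^-1` N) = 0}.
Proof.
move=> k1 mN N0; have k0 := ltnW k1.
pose Phi (y : 'rV[R]_k) : \bar R := (\1_N y)%:E.
have mPhi : measurable_fun setT Phi by apply/measurable_EFinP; exact: measurable_indic.
have Phi0 y : 0 <= Phi y by rewrite lee_fin indicE.
have w0 alpha t : (0 < t)%R -> weighted_int alpha Phi t = 0.
  move=> t0; have mNt : measurable ((fun y : 'rV[R]_k => (0 + t *: y)%R) @^-1` N).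
    by rewrite -[X in measurable X]setTI; exact: measurable_affine_rV.
  rewrite /weighted_int (integral_eq_off_null (N := (fun y => (0 + t *: y)%R) @^-1` N)
    (g := cst 0))//.
  - exact: integral0.
  - by rewrite [LHS]vol_affine ?gt_eqF// [X in _ * X]N0 mule0.
  - by move=> y; rewrite mule_ge0// lee_fin powR_ge0.
  - by move=> y _ /= Ny; rewrite /Phi indicE memNset ?mule0//; rewrite add0r in Ny.
have S0 (n : nat) : {ae mu, forall s, (0 < s)%R -> sphere_int Phi s <= (bv * n.+1%:R^-1)%:E}.
  apply: contrapT => nS.
  have n0 : (0 < n.+1%:R^-1 :> R)%R by rewrite invr_gt0.
  have [d d0 H] := not_ae_weighted_int_le k1 mPhi Phi0 n0 nS.
  (* Since [d] may exceed 1, the maximum with 1/2 keeps alpha positive. *)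
  pose alpha := Num.max (1 - d / 2)%R (2^-1)%R.
  have al1 : (0 < alpha < 1)%R.
    by rewrite lt_max gt_max invr_gt0 ltr0n orbT/= invf_lt1// ltr1n andbT; lra.
  apply: (H alpha al1); first by rewrite lt_max; apply/orP; left; lra.
  apply: aeW => t t0; rewrite w0// mule_ge0 ?lee_fin ?(ltW n0)//.
  by apply: integral_ge0 => y _; rewrite lee_fin powR_ge0.
have [M [mM M0 PM]] : mu.-negligible (\bigcup_n
    ~` [set s | (0 < s)%R -> sphere_int Phi s <= (bv * n.+1%:R^-1)%:E]).
  by apply: negligible_bigcup => n; exact: S0.
exists M; split => // t /= nt; apply: PM.
apply: contrapT => nM; apply: nt => t0.
have h n : sphere_int Phi t <= (bv * n.+1%:R^-1)%:E.
  by apply: contrapT => nh; apply: nM; exists n => //= /(_ t0).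
have St0 : sphere_int Phi t = 0.
  have s0 := sphere_int_ge0 Phi0 t.
  have bv0 := ball_volume_gt0 R k.
  move: h s0; case: (sphere_int Phi t) => [s| |]//; last by move=> /(_ 0%N).
  move=> h; rewrite lee_fin le_eqVlt => /predU1P[<-//|s0].
  have := h (Num.truncn (bv / s)); rewrite lee_fin.
  rewrite ler_pdivlMr// -ler_pdivlMl// mulrC leNgt => /negP[].
  exact: truncnS_gt.
transitivity (\int[sphere_measure R k]_(y in unit_sphere) Phi (t *: y)%R).
  have mSN : measurable (unit_sphere `&` (fun y : 'rV[R]_k => t *: y)%R @^-1` N).
    apply: measurableI; first exact: measurable_unit_sphere.
    rewrite -[X in measurable X]setTI.
    by apply: (@measurable_scale_rV _ _ R k (cst t) id).
  rewrite integral_mkcond.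
  rewrite -[LHS]mul1e -integral_cst//.
  rewrite [LHS]integral_mkcond; apply: eq_integral => y _.
  rewrite !patchE /Phi indicE in_setI; case: (y \in unit_sphere) => //=.
  by rewrite -[_ \in _ @^-1` _]/(t *: y \in N)%R; case: ifP.
by rewrite integral_sphere// St0 mule0.
Qed.

End sphere.

(** * The tensor product and its Borel version *)

Section tensor.
Context (R : realType) (m n : nat).
Local Notation k := (m * n)%N.
Implicit Types (f g : 'I_m -> 'rV[R]_n -> R) (x : 'rV[R]_n) (t : R).

Lemma tensor_scale f x t (y : 'rV[R]_k) : tensor f x t y = tensor f x 1 (t *: y).
Proof.
apply: eq_bigr => i _; rewrite scale1r; congr `|f i (x - _)|.
by apply/rowP => j; rewrite /block !mxE.
Qed.

Lemma blockE (y : 'rV[R]_k) i : block y i = \row_j y ord0 (mxvec_index i j).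
Proof. by apply/rowP => j; rewrite /block !mxE. Qed.

Lemma mxvec_index_inj (i : 'I_m) : injective (@mxvec_index m n i).
Proof. by move=> j j' /cast_ord_inj/enum_rank_inj[]. Qed.

Lemma measurable_block i : measurable_fun setT (fun y : 'rV[R]_k => block y i).
Proof.
apply/measurable_fun_rVP => j.
apply: (eq_measurable_fun (coor (mxvec_index i j))); last exact: measurable_coor.
by move=> y _; rewrite /coor /= blockE mxE.
Qed.

Lemma measurable_tensor g x : (forall i, measurable_fun setT (g i)) ->
  measurable_fun setT (tensor g x 1).
Proof.
move=> mg; apply: measurable_prod => i _.
apply: (measurableT_comp (@normr_measurable R setT)); apply: (measurableT_comp (mg i)).
apply: (eq_measurable_fun (fun y => x + (-1) *: block y i)).
  by move=> y _; rewrite scale1r scaleN1r.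
exact: measurableT_comp (measurable_affine_rV x (-1)) (measurable_block i).
Qed.

Lemma tensor_ae_eq f g x :
  (forall i, {ae rV_lebesgue R n, forall y, f i y = g i y}) ->
  exists N : set 'rV[R]_k, [/\ measurable N, vol N = 0%E &
    forall y, ~ N y -> tensor f x 1 y = tensor g x 1 y].
Proof.
move=> fg.
have {fg} /choice[N NP] : forall i, exists N : set 'rV[R]_n,
    [/\ measurable N, vol N = 0%E & forall y, ~ N y -> f i y = g i y].
  move=> i; have [N [mN N0 PN]] := fg i; exists N; split => // y nNy.
  by apply: contrapT => nfg; apply: nNy; exact: PN.
pose N' i := (fun v : 'rV[R]_n => x + (-1) *: v)%R @^-1` N i.
have mN' i : measurable (N' i).
  have [mN _ _] := NP i; rewrite -[X in measurable X]setTI.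
  exact: measurable_affine_rV.
have N'0 i : vol (N' i) = 0%E.
  have [mN N0 _] := NP i; rewrite [LHS]vol_affine ?oppr_eq0 ?oner_eq0//.
  by rewrite [X in (_ * X)%E]N0 mule0.
pose P i := (fun y : 'rV[R]_k => block y i) @^-1` N' i.
have mP i : measurable (P i).
  by rewrite -[X in measurable X]setTI; exact: measurable_block.
have P0 i : vol (P i) = 0%E.
  rewrite -(vol_select_null (@mxvec_index_inj i) (mN' i) (N'0 i)).
  by congr vol; apply/seteqP; split => y; rewrite /P /= blockE.
(* The finite family of exceptional sets is padded by empty sets into a sequence, so that countable
   subadditivity applies. *)
pose Q (j : nat) := if insub j is Some i then P i else set0.
have mQ j : measurable (Q j) by rewrite /Q; case: insubP.
have mU : measurable (\bigcup_j Q j) by exact: bigcup_measurable.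
exists (\bigcup_j Q j); split => //.
  apply/negligibleP => //; apply: negligible_bigcup => j.
  apply/negligibleP; first exact: mQ.
  by rewrite /Q; case: insubP => [i _ _|_]; [exact: P0|exact: measure0].
move=> y nP; apply: eq_bigr => i _; congr `|_|.
have [_ _ h] := NP i; apply: h => Ny; apply: nP; exists i => //.
by rewrite /Q valK /P /N' /= scaleN1r; rewrite scale1r in Ny.
Qed.

End tensor.

(** * Suprema of averages *)

Section ess_sup_positive.
Context {R : realType}.
Local Notation mu := (@lebesgue_measure R).
Local Open Scope ereal_scope.
Implicit Types (F G : R -> \bar R) (y : \bar R).

(** The half-line ]-oo, 0] is null for the restricted measure, so exceptional sets pass between the
    two formulations. Taking [y] to be the essential supremum itself gives its defining a.e.
    bound. *)
Lemma ess_sup_pos_leP F y :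
  ess_sup_pos F <= y <-> {ae mu, forall t, (0 < t)%R -> F t <= y}.
Proof.
have mI : measurable (`]0%R, +oo[%classic : set R) by exact: measurable_itv.
split=> [/ess_supP[N [mN N0 PN]]|[N [mN N0 PN]]].
  exists (N `&` `]0%R, +oo[%classic); split => //; first exact: measurableI.
  move=> t /= nt; split; last first.
    by rewrite /= in_itv/= andbT ltNge; apply/negP => t0; apply: nt; rewrite ltNge t0.
  by apply: PN => /= Ft; apply: nt => _.
apply/ess_supP; exists (N `|` `]-oo, 0%R]%classic); split.
- by apply: measurableU => //; exact: measurable_itv.
- rewrite /= /mrestr setIUl (_ : `]-oo, 0%R] `&` _ = set0) ?setU0; last first.
    apply/seteqP; split => // t [] /=; rewrite !in_itv/= andbT => t0 t1.
    by have := lt_le_trans t1 t0; rewrite ltxx.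
  by apply: (subset_measure0 (measurableI _ _ mN mI) mN _ N0); exact: subIsetl.
move=> t /= nt; have [t0|t0] := ltP 0%R t; last by right; rewrite /= in_itv.
by left; apply: PN => /= /(_ t0).
Qed.

Lemma eq_ess_sup_pos F G : {ae mu, forall t, (0 < t)%R -> F t = G t} ->
  ess_sup_pos F = ess_sup_pos G.
Proof.
move=> FG; apply/eqP; rewrite eq_le; apply/andP; split.
  apply/ess_sup_pos_leP.
  have /ess_sup_pos_leP := lexx (ess_sup_pos G).
  case: FG => N [mN N0 PN] [M [mM M0 PM]].
  exists (N `|` M); split; [exact: measurableU|by rewrite measureU0|].
  move=> t /= nt; apply: contrapT => /not_orP[nN nM].
  apply: nt => t0; have -> : F t = G t.
    by move: t0; apply: contrapT => h; apply: nN; exact: PN.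
  by move: t0; apply: contrapT => h; apply: nM; exact: PM.
apply/ess_sup_pos_leP.
have /ess_sup_pos_leP := lexx (ess_sup_pos F).
case: FG => N [mN N0 PN] [M [mM M0 PM]].
exists (N `|` M); split; [exact: measurableU|by rewrite measureU0|].
move=> t /= nt; apply: contrapT => /not_orP[nN nM].
apply: nt => t0; have <- : F t = G t.
  by move: t0; apply: contrapT => h; apply: nN; exact: PN.
by move: t0; apply: contrapT => h; apply: nM; exact: PM.
Qed.

(** This rests on the positive half-line not being null: a negative a.e. bound would make []0, 1]]
    null. *)
Lemma ess_sup_pos_ge0 F : (forall t, 0 <= F t) -> 0 <= ess_sup_pos F.
Proof.
move=> F0; rewrite leNgt; apply/negP => Fneg.
have /ess_sup_pos_leP[N [mN N0 PN]] := lexx (ess_sup_pos F).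
have : mu `]0%R, 1%R]%classic = 0.
  apply: (subset_measure0 _ mN _ N0); first exact: measurable_itv.
  move=> t; rewrite /= in_itv/= => /andP[t0 _]; apply: PN => /= /(_ t0) Ft.
  by have := le_lt_trans (le_trans (F0 t) Ft) Fneg; rewrite ltxx.
rewrite lebesgue_measure_itv/= lte_fin ltr01 oppr0 adde0 => /eqP.
by rewrite eqe oner_eq0.
Qed.

End ess_sup_positive.

(** Finite and infinite limits are treated by one criterion; [0 <= l] excludes the value -oo. *)
Lemma cvge_from_below (R : realType) (T : Type) (F : set_system T)
    (FF : Filter F) (h : T -> \bar R) (l : \bar R) : (0 <= l)%E ->
  (\forall a \near F, h a <= l)%E ->
  (forall y : R, (y%:E < l)%E -> \forall a \near F, (y%:E < h a)%E) ->
  h @ F --> l.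
Proof.
case: l => [l| |]// l0 hl hy; last by apply/cvgeyPgt => A; apply: hy; rewrite ltry.
apply/fine_cvgP; split.
  have := hy (l - 1); rewrite lte_fin gtrBl ltr01 => /(_ isT).
  apply: filterS2 hl => a ha ah.
  by rewrite fin_numElt (lt_trans (ltNyr _) ah)/= (le_lt_trans ha)// ltry.
apply/cvgrPdist_le => e e0.
have := hy (l - e); rewrite lte_fin gtrBl e0 => /(_ isT).
apply: filterS2 hl => a /=; case: (h a) => [r| |]//.
rewrite lee_fin lte_fin => rl lr /=.
by rewrite ger0_norm ?subr_ge0// lerBlDr -lerBlDl ltW.
Qed.

(** * Inequalities and limits for a Borel integrand *)

Section limits.
Context (R : realType) (k : nat).
Hypothesis k1 : (1 < k)%N.
Local Notation mu := (@lebesgue_measure R).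
Local Notation bv := (ball_volume R k).
Local Open Scope ereal_scope.
Variable Phi : 'rV[R]_k -> \bar R.
Hypotheses (mPhi : measurable_fun setT Phi) (Phi0 : forall y, 0 <= Phi y).

Let k0 : (0 < k)%N := ltnW k1.

Definition ball_mean_sup : \bar R :=
  ereal_sup [set bv^-1%:E * ball_int Phi t | t in [set t : R | (0 < t)%R]].

Definition weight_mass (alpha : R) : R := fine (ball_weight k alpha).

Definition weighted_mean_sup (alpha : R) : \bar R :=
  ess_sup_pos (fun t => (weight_mass alpha)^-1%:E * weighted_int alpha Phi t).

Definition sphere_mean_sup : \bar R :=
  ess_sup_pos (fun t => bv^-1%:E * sphere_int Phi t).

Let bv0 : (0 < bv)%R := ball_volume_gt0 R k.

Lemma weight_massE (alpha : R) : (0 < alpha < 1)%R ->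
  ball_weight k alpha = (weight_mass alpha)%:E.
Proof. by move=> /andP[a0 a1]; rewrite /weight_mass ball_weight_beta. Qed.

Lemma weight_mass_ge (alpha : R) : (0 < alpha < 1)%R -> (bv <= weight_mass alpha)%R.
Proof.
move=> a01; have /andP[a0 a1] := a01.
rewrite -lee_fin -weight_massE//; apply: le_trans (ball_weight_ge k0 k1 a01).
by rewrite lee_fin ler_pdivlMr ?subr_gt0// ler_piMr ?(ltW bv0)// gerBl ltW.
Qed.

Lemma weight_mass_gt0 (alpha : R) : (0 < alpha < 1)%R -> (0 < weight_mass alpha)%R.
Proof. by move=> /weight_mass_ge; exact: lt_le_trans. Qed.

Lemma weighted_mean_sup_leP (alpha : R) (y : \bar R) : (0 < alpha < 1)%R ->
  weighted_mean_sup alpha <= y <->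
  {ae mu, forall t, (0 < t)%R -> weighted_int alpha Phi t <= ball_weight k alpha * y}.
Proof.
move=> a01; rewrite ess_sup_pos_leP.
split=> -[N [mN N0 PN]]; exists N; split => // t /= nt; apply: PN => /= h; apply: nt => t0.
  by have := h t0; rewrite lee_pdivrMl ?weight_mass_gt0// weight_massE.
by rewrite lee_pdivrMl ?weight_mass_gt0// -weight_massE//; exact: h.
Qed.

Lemma sphere_mean_sup_leP (y : \bar R) :
  sphere_mean_sup <= y <->
  {ae mu, forall t, (0 < t)%R -> sphere_int Phi t <= bv%:E * y}.
Proof.
rewrite ess_sup_pos_leP.
split=> -[N [mN N0 PN]]; exists N; split => // t /= nt; apply: PN => /= h; apply: nt => t0.
  by have := h t0; rewrite lee_pdivrMl.
by rewrite lee_pdivrMl//; exact: h.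
Qed.

Lemma weighted_mean_sup_ge0 (alpha : R) : 0 <= weighted_mean_sup alpha.
Proof.
apply: ess_sup_pos_ge0 => t; rewrite mule_ge0 ?weighted_int_ge0// lee_fin invr_ge0.
by rewrite fine_ge0// integral_ge0// => y _; rewrite lee_fin powR_ge0.
Qed.

Lemma sphere_mean_sup_ge0 : 0 <= sphere_mean_sup.
Proof.
apply: ess_sup_pos_ge0 => t; rewrite mule_ge0 ?sphere_int_ge0// lee_fin invr_ge0.
exact: ltW.
Qed.

Lemma ball_mean_sup_ge0 : 0 <= ball_mean_sup.
Proof.
apply: (@le_trans _ _ (bv^-1%:E * ball_int Phi 1)).
  by rewrite mule_ge0 ?ball_int_ge0// lee_fin invr_ge0 ltW.
by apply: ereal_sup_ubound; exists 1%R => //=.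
Qed.

Lemma ball_mean_sup_le (alpha : R) : (0 < alpha < 1)%R ->
  ball_mean_sup <= weighted_mean_sup alpha.
Proof.
move=> a01; have W0 := weight_mass_gt0 a01.
apply: ge_ereal_sup => _ [t /= t0 <-].
have /(weighted_mean_sup_leP _ a01) h := lexx (weighted_mean_sup alpha).
have C0 : 0 <= ball_weight k alpha * weighted_mean_sup alpha.
  by rewrite mule_ge0 ?weighted_mean_sup_ge0// weight_massE// lee_fin ltW.
have := ball_int_le_weighted k0 mPhi Phi0 a01 C0 t0 h.
rewrite lee_pdivrMl// muleC weight_massE// muleCA lee_pmul2l//.
Qed.

Lemma weighted_mean_sup_le (alpha : R) : (0 < alpha < 1)%R ->
  weighted_mean_sup alpha <= sphere_mean_sup.
Proof.
move=> a01; apply/weighted_mean_sup_leP => //.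
have /sphere_mean_sup_leP h := lexx sphere_mean_sup.
have C0 : 0 <= bv%:E * sphere_mean_sup.
  by rewrite mule_ge0 ?sphere_mean_sup_ge0// lee_fin ltW.
apply: aeW => t t0.
have := weighted_int_le_sphere k0 mPhi Phi0 alpha C0 t0 h.
by rewrite -muleA lee_pmul2l// muleC.
Qed.

Lemma weighted_mean_sup_cvg1 :
  weighted_mean_sup alpha @[alpha --> 1^'-] --> sphere_mean_sup.
Proof.
have near01 : \forall alpha \near (1%R : R)^'-, (0 < alpha < 1)%R.
  near=> alpha; apply/andP; split; near: alpha; last exact: nbhs_left_lt.
  by apply: nbhs_left_gt.
apply: cvge_from_below; first exact: sphere_mean_sup_ge0.
  by apply: filterS near01 => alpha; exact: weighted_mean_sup_le.
move=> y yS.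
have [y0|y0] := ltP y 0%R.
  apply: nearW => alpha; apply: lt_le_trans (weighted_mean_sup_ge0 alpha).
  by rewrite lte_fin.
(* The concentration lemma needs a positive level and y may be 0, so a level strictly between y and
   the supremum is used. *)
have [z yz zS] : exists2 z : R, (y < z)%R & z%:E < sphere_mean_sup.
  have [z yz zS] := exists_real_between yS.
  exists ((y + z) / 2)%R; first by rewrite midf_lt.
  by apply: lt_le_trans zS; rewrite lte_fin midf_lt.
have z0 : (0 < z)%R by exact: le_lt_trans yz.
have nz : ~ {ae mu, forall s, (0 < s)%R -> sphere_int Phi s <= (bv * z)%:E}.
  by rewrite EFinM => /sphere_mean_sup_leP; rewrite leNgt zS.
have [d d0 H] := not_ae_weighted_int_le k1 mPhi Phi0 z0 nz.
near=> alpha; have a01 : (0 < alpha < 1)%R by near: alpha.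
rewrite ltNge; apply/negP => wy; apply: (H alpha a01).
  by near: alpha; apply: nbhs_left_gt; rewrite gtrBl.
by apply/weighted_mean_sup_leP => //; rewrite (le_trans wy)// lee_fin ltW.
Unshelve. all: by end_near. Qed.

Lemma weighted_mean_sup_cvg0 (alpha0 : R) : (0 < alpha0 < 1)%R ->
  weighted_mean_sup alpha0 < +oo ->
  weighted_mean_sup alpha @[alpha --> 0^'+] --> ball_mean_sup.
Proof.
move=> a01 Soo; have /andP[a0 a1] := a01.
have Moo := le_lt_trans (ball_mean_sup_le a01) Soo.
have ballM t : (0 < t)%R -> ball_int Phi t <= bv%:E * ball_mean_sup.
  by move=> t0; rewrite -lee_pdivrMl//; apply: ereal_sup_ubound; exists t.
have /(weighted_mean_sup_leP _ a01) wS := lexx (weighted_mean_sup alpha0).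
have le_M := ball_mean_sup_le.
move: le_M ballM wS Soo Moo ball_mean_sup_ge0 (weighted_mean_sup_ge0 alpha0).
rewrite weight_massE//.
case: ball_mean_sup => [M| |]//; case: (weighted_mean_sup alpha0) => [S0| |]//.
move=> le_M ballM wS _ _; rewrite !lee_fin => M0 S00.
(* A bound for the weighted integrals at alpha0, expressed in the normalization of the uniform
   average. *)
pose C := (weight_mass alpha0 * S0 / bv)%R.
have C0 : (0 <= C)%R by rewrite !mulr_ge0 ?invr_ge0 ?(ltW bv0)// ltW// weight_mass_gt0.
apply: (@squeeze_cvge _ _ _ _ (cst M%:E) _ (fun alpha => (M + alpha * (C / alpha0))%:E)).
- near=> alpha.
  have al0 : (0 < alpha)%R by near: alpha; exact: nbhs_right_gt.
  have ala : (alpha < alpha0)%R by near: alpha; exact: nbhs_right_lt.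
  have al01 : (0 < alpha < 1)%R by rewrite al0 (lt_trans ala).
  rewrite le_M//=; apply/weighted_mean_sup_leP => //.
  pose th := (alpha / alpha0)%R.
  have th0 : (0 <= th)%R by rewrite divr_ge0// ltW.
  have th1 : (th <= 1)%R by rewrite ler_pdivrMr// mul1r ltW.
  have th01 : (0 <= th <= 1)%R by rewrite th0.
  have [N [mN N0 PN]] := wS.
  exists N; split => // t /= nt; apply: PN => /= h; apply: nt => t0.
  have := weighted_int_interp mPhi Phi0 alpha0 t th01.
  rewrite /th divfK ?gt_eqF// => /le_trans; apply.
  apply: (@le_trans _ _ ((1 - th)%:E * (bv%:E * M%:E) +
      th%:E * ((weight_mass alpha0)%:E * S0%:E))).
    apply: leeD; apply: lee_wpmul2l; rewrite ?lee_fin ?subr_ge0//.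
      exact: ballM.
    exact: h.
  rewrite weight_massE// -!EFinM -EFinD lee_fin.
  have -> : ((1 - th) * (bv * M) + th * (weight_mass alpha0 * S0) =
      bv * ((1 - th) * M + th * C))%R.
    by rewrite /C; field; rewrite gt_eqF.
  have -> : (alpha * (C / alpha0) = th * C)%R by rewrite /th; ring.
  (* The interpolation bound carries the mass v_k, the target carries W(alpha); since the weight has
     mass W(alpha) >= v_k and the bracket is nonnegative, both can be enlarged. *)
  apply: ler_pM => //; first exact: ltW.
  - by rewrite addr_ge0// mulr_ge0// subr_ge0.
  - exact: weight_mass_ge.
  - by rewrite lerD2r ler_piMl// gerBl.
- exact: cvg_cst.
apply: cvg_EFin; first by apply: nearW.
rewrite -[X in _ --> X]addr0; apply: cvgD; first exact: cvg_cst.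
rewrite -[X in _ --> X](mul0r (C / alpha0)%R); apply: cvgMl.
by apply: cvg_at_right_filter; exact: cvg_id.
Unshelve. all: by end_near. Qed.

End limits.

(** * From the maximal functions to a Borel integrand *)

Section bridge.
Context (R : realType) (m n : nat).
Hypothesis hmn : (2 <= m * n)%N.
Local Notation k := (m * n)%N.
Local Notation mu := (@lebesgue_measure R).
Local Notation bv := (ball_volume R k).
Local Open Scope ereal_scope.
Variables (f : 'I_m -> 'rV[R]_n -> R) (x : 'rV[R]_n).
Variables (Psi : 'rV[R]_k -> R) (N : set 'rV[R]_k).
Hypotheses (mPsi : measurable_fun setT Psi) (Psi0 : forall y, (0 <= Psi y)%R).
Hypotheses (mN : measurable N) (N0 : vol N = 0).
Hypothesis fPsi : forall y, ~ N y -> tensor f x 1 y = Psi y.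

Let Phi y := (Psi y)%:E.

Let mPhi : measurable_fun setT Phi.
Proof. exact/measurable_EFinP. Qed.

Let Phi0 y : 0 <= Phi y.
Proof. by rewrite lee_fin. Qed.

Lemma tensor_ge0 t y : (0 <= tensor f x t y)%R.
Proof. exact: prodr_ge0. Qed.

Let Nt t := (fun y : 'rV[R]_k => (0 + t *: y)%R) @^-1` N.

Let mNt t : measurable (Nt t).
Proof. by rewrite -[X in measurable X]setTI; exact: measurable_affine_rV. Qed.

Let Nt0 t : (0 < t)%R -> vol (Nt t) = 0.
Proof. by move=> t0; rewrite [LHS]vol_affine ?gt_eqF// [X in _ * X]N0 mule0. Qed.

Let fPsit t y : ~ Nt t y -> tensor f x t y = Psi (t *: y)%R.
Proof. by rewrite /Nt /= add0r tensor_scale; exact: fPsi. Qed.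

Lemma MmaxE : Mmax f x = ball_mean_sup Phi.
Proof.
congr ereal_sup; apply: eq_imagel => t /= t0; congr (_ * _).
apply: (integral_eq_off_null (mNt t) (Nt0 t0)).
- by move=> y; rewrite lee_fin tensor_ge0.
- by move=> y; exact: Phi0.
- by move=> y _ /fPsit ->.
Qed.

Lemma Smax_alphaE alpha : (0 < alpha < 1)%R ->
  Smax_alpha alpha f x = weighted_mean_sup Phi alpha.
Proof.
move=> /andP[a0 a1]; apply: eq_ess_sup_pos; apply: aeW => t t0.
have k0 : (0 < k)%N by exact: ltnW.
congr (_ * _).
  rewrite /weight_mass ball_weight_beta//= sphere_areaE//; congr EFin.
  by rewrite -invf_div; congr (_^-1)%R; ring.
apply: (integral_eq_off_null (mNt t) (Nt0 t0)).
- by move=> y; rewrite lee_fin divr_ge0 ?tensor_ge0// powR_ge0.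
- by move=> y; rewrite mule_ge0// lee_fin powR_ge0.
- by move=> y _ /fPsit ->; rewrite powRN mulrC EFinM.
Qed.

(** A dilated ball meets the null set in a null set at every scale, as the true supremum in [Mmax]
    demands. For spheres this holds only for almost every t, which is exactly what an essential
    supremum tolerates. *)
Lemma SmaxE : Smax f x = sphere_mean_sup Phi.
Proof.
have k0 : (0 < k)%N by exact: ltnW.
apply: eq_ess_sup_pos.
have [M [mM M0 PM]] := ae_sphere_null hmn mN N0.
exists M; split => // t /= nt; apply: PM => /= h; apply: nt => t0.
have {}h := h t0.
have -> : \int[sphere_measure R k]_(y in unit_sphere) (tensor f x t y)%:E =
    \int[sphere_measure R k]_(y in unit_sphere) Phi (t *: y)%R.
  apply: (integral_eq_off_null _ h).
  - apply: measurableI; first exact: measurable_unit_sphere.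
    rewrite -[X in measurable X]setTI.
    by apply: (@measurable_scale_rV _ _ R k (cst t) id).
  - by move=> y; rewrite lee_fin tensor_ge0.
  - by move=> y; exact: Phi0.
  - move=> y Sy Ny; rewrite fPsit// /Nt /= add0r => tyN.
    by apply: Ny; split.
rewrite integral_sphere// muleA -EFinM sphere_areaE//; congr (_%:E * _).
by rewrite invfM mulrAC mulVf ?mul1r// pnatr_eq0 -lt0n.
Qed.

End bridge.

Theorem theorem1 (R : realType) (m n : nat)
  (hm : (1 <= m)%N) (hn : (1 <= n)%N) (hmn : (2 <= m * n)%N)
  (f : 'I_m -> 'rV[R]_n -> R) (hf : forall i, L1loc (f i))
  (x : 'rV[R]_n) :
  [/\ forall alpha : R, 0 < alpha < 1 ->
        (Mmax f x <= Smax_alpha alpha f x <= Smax f x)%E,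
      Smax_alpha alpha f x @[alpha --> 1^'-] --> Smax f x &
      (exists2 alpha0 : R, 0 < alpha0 < 1 & (Smax_alpha alpha0 f x < +oo)%E) ->
        Smax_alpha alpha f x @[alpha --> 0^'+] --> Mmax f x].
Proof.
have [g hg] := choice hf.
have mg i : measurable_fun setT (g i) by case: (hg i).
have fg i : {ae rV_lebesgue R n, forall y, f i y = g i y} by case: (hg i).
have [N [mN N0 fgN]] := tensor_ae_eq x fg.
have mPsi := measurable_tensor x mg.
pose Phi y := (tensor g x 1 y)%:E.
have mPhi : measurable_fun setT Phi by exact/measurable_EFinP.
have Psi0 y : 0 <= tensor g x 1 y by exact: tensor_ge0.
have Phi0 y : (0 <= Phi y)%E by rewrite lee_fin.
have ME : Mmax f x = ball_mean_sup Phi by exact: (MmaxE Psi0 mN N0 fgN).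
have SE : Smax f x = sphere_mean_sup Phi by exact: (SmaxE hmn mPsi Psi0 mN N0 fgN).
have SaE alpha : 0 < alpha < 1 -> Smax_alpha alpha f x = weighted_mean_sup Phi alpha.
  exact: (Smax_alphaE hmn Psi0 mN N0 fgN).
split=> [alpha a01||[alpha0 a01 Soo]].
- rewrite ME SE SaE// ball_mean_sup_le// weighted_mean_sup_le//.
(* [SaE] is available for alpha in (0,1) only, so the two functions of alpha are compared on a left
   neighbourhood of 1. *)
- rewrite SE; apply: cvg_trans (weighted_mean_sup_cvg1 hmn mPhi Phi0).
  apply: near_eq_cvg; near=> alpha; rewrite SaE//; apply/andP; split.
    by near: alpha; exact: nbhs_left_gt.
  by near: alpha; exact: nbhs_left_lt.
- rewrite SaE// in Soo; rewrite ME.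
  apply: cvg_trans (weighted_mean_sup_cvg0 hmn mPhi Phi0 a01 Soo).
  apply: near_eq_cvg; near=> alpha; rewrite SaE//; apply/andP; split.
    by near: alpha; exact: nbhs_right_gt.
  by near: alpha; exact: nbhs_right_lt.
Unshelve. all: by end_near. Qed.
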